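(* Let $G=(V,E)$ be a finite connected chordal graph with $m$ edges whose vertex degrees are bounded by a constant. Then the eccentricities of all vertices of $G$ can be computed in total $O(m)$ time.
   Context: A graph is chordal if every induced cycle of length at least 4 has a chord. The eccentricity of $v$ is $e(v)=\max_{u\in V}d(v,u)$ where $d$ is the shortest-path distance. *)

(* Defs.v *)
From mathcomp Require Import all_boot.
Set Implicit Arguments. Unset Strict Implicit. Unset Printing Implicit Defensive.

Definition nedges (n : nat) (e : rel 'I_n) : nat :=
  #|[set p : 'I_n * 'I_n | (p.1 < p.2)%N && e p.1 p.2]|.

Definition degree (n : nat) (e : rel 'I_n) (v : 'I_n) : nat := #|[set u | e v u]|.

Definition gconnected (n : nat) (e : rel 'I_n) : Prop := forall u v, connect e u v.

Definition chordal (n : nat) (e : rel 'I_n) : Prop :=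
  forall c : seq 'I_n, uniq c -> (4 <= size c)%N -> cycle e c ->
    exists x y, [&& x \in c, y \in c, x != y, y != next c x, x != next c y & e x y].

Definition is_dist (n : nat) (e : rel 'I_n) (u v : 'I_n) (k : nat) : Prop :=
  (exists p, [/\ path e u p, last u p = v & size p = k]) /\
  (forall p, path e u p -> last u p = v -> (k <= size p)%N).

Definition is_ecc (n : nat) (e : rel 'I_n) (u : 'I_n) (k : nat) : Prop :=
  (exists v, is_dist e u v k) /\ (forall v k', is_dist e u v k' -> (k' <= k)%N).

Inductive instr :=
  | IConst of nat & nat
  | IAdd of nat & nat & nat
  | ISub of nat & nat & nat    (* ISub r a b   : R[r] := R[a] - R[b] (truncated) *)
  | ILoad of nat & nat
  | IStore of nat & nat
  | IJz of nat & nat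
  | IJmp of nat
  | IHalt.                     (* halt (also when pc is out of range)     *)

Definition upd (m : nat -> nat) (a x : nat) : nat -> nat :=
  fun i => if i == a then x else m i.

(* exec P fuel pc m = Some m' iff the program halts within fuel steps
   (each executed instruction, including the final halt, costs 1),
   with final memory m'. *)
Fixpoint exec (P : seq instr) (fuel pc : nat) (m : nat -> nat) : option (nat -> nat) :=
  match fuel with
  | 0 => None
  | f.+1 =>
    match nth IHalt P pc with
    | IHalt => Some m
    | IConst r k => exec P f pc.+1 (upd m r k)
    | IAdd r a b => exec P f pc.+1 (upd m r (m a + m b))
    | ISub r a b => exec P f pc.+1 (upd m r (m a - m b))
    | ILoad r a => exec P f pc.+1 (upd m r (m (m a)))
    | IStore a b => exec P f pc.+1 (upd m (m a) (m b))
    | IJz a l => exec P f (if m a == 0 then l else pc.+1) m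
    | IJmp l => exec P f l m
    end
  end.

Definition init_mem (s : seq nat) : nat -> nat := fun i => nth 0 s i.

(* adjacency-list encoding of the graph:
   [n; deg 0; neighbours of 0 ...; deg 1; neighbours of 1 ...; ...] *)
Definition nbrs (n : nat) (e : rel 'I_n) (v : 'I_n) : seq nat :=
  [seq val u | u <- enum 'I_n & e v u].

Definition enc_graph (n : nat) (e : rel 'I_n) : seq nat :=
  n :: flatten [seq size (nbrs e v) :: nbrs e v | v <- enum 'I_n].

(* Main.v *)
Require Import Defs.
From mathcomp Require Import all_boot zify.
Set Implicit Arguments. Unset Strict Implicit. Unset Printing Implicit Defensive.

(* Let y be farthest from vertex 0 and let c be a middle vertex,
   on a geodesic from 0 to y, at distance about ecc y / 2 from y.  In a chordal
   graph c is nearly central: ecc c <= ecc x + 3 for every x.  The vertices at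
   distance k = 6 from c through which geodesics from c to v leave the ball of
   radius k form a clique, the slice of v.  Since c is nearly central, no vertex
   behind the slice is farthest from v, and ecc v - d(c, v) depends only on the
   slice.  When degrees are bounded by D, the ball has at most (D + 1)^k vertices,
   so one breadth-first search from each of them sorts the vertices into a bounded
   number of classes with equal slices, and one further search per class gives
   all eccentricities.

   The basic tool is that two vertices at the same distance from a root which are
   joined by a path staying farther away from the root are equal or adjacent: an
   induced upper path and an induced lower path would close a chordless cycle.

   The machine has no free memory at the start, since the input fills the low
   addresses and constant addresses are the only ones that can be named.  The
   end of the input is found with cells 0 and 2 as only scratch space; their
   contents (n and the first neighbour of vertex 0) are recomputed from the other
   adjacency lists. *)

(** * Geodesics in chordal graphs *)

(** The program is fixed before [D]: no degree bound occurs in it, and [D] enters only the running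
    time, through the size of the ball. So the radius 6 has to be absolute, which is where the
    additive form [ecc c <= ecc x + 3] matters. If [u] is farthest from [v] and not behind the slice
    of [v'], some geodesic from [v'] to [u] passes through a vertex [a] of that slice. When [v] has
    the same slice, [a] lies between [c] and both vertices, so comparing the routes through [a]
    gives [ecc v - d(c, v) <= ecc v' - d(c, v')]; exchanging the vertices gives equality. Classes
    are found without sorting: a vertex receives a number whose binary digits describe its slice,
    and this number is itself the index into a table of answers. All costs are counted in [n], and
    connectedness turns this into a bound in the number of edges. *)

Section ShortestPaths.
Variables (T : finType) (e : rel T).

(** A shortest path is induced, since a chord would shorten it. Being consecutive is expressed by
    splitting the list, the form in which [next] on a longer cycle can be computed. *)
Lemma induced_path (a b : T) : connect e a b ->
  exists p, [/\ path e a p, last a p = b, uniq (a :: p) &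
    forall x y, x \in a :: p -> y \in a :: p -> x != y -> e x y -> e y x ->
      exists s1 s2, a :: p = s1 ++ x :: y :: s2 \/ a :: p = s1 ++ y :: x :: s2].
Proof.
move=> cab.
have exk : exists k, [exists t : k.-tuple T, path e a t && (last a t == b)].
  case/connectP: cab => p pp ->.
  by exists (size p); apply/existsP; exists (in_tuple p); rewrite pp eqxx.
have [m /existsP[t /andP[pt /eqP lt]] mmin] := find_ex_minn exk.
have szt : size t = m by rewrite size_tuple.
have {mmin} tmin p : path e a p -> last a p = b -> size t <= size p.
  move=> pp lp; rewrite szt; apply: mmin; apply/existsP.
  by exists (in_tuple p); rewrite pp lp eqxx.
exists t; move: (val t) pt lt tmin => p pp lp pmin {t szt m exk}.
have up : uniq (a :: p).
  case/shortenP: pp lp (pmin) => p' pp' up' sp' lp' pmin'.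
  have up1 : uniq p' by case/andP: up'.
  have up : uniq p := leq_size_uniq up1 sp' (pmin' _ pp' lp').
  have eqp : p' =i p by apply: (uniq_min_size up1 sp' (pmin' _ pp' lp')).2.
  by rewrite /= up andbT -eqp; case/andP: up'.
split=> // x y xp yp.
wlog ltxy : x y xp yp / index x (a :: p) <= index y (a :: p).
  move=> H ne exy eyx; case: (leqP (index x (a :: p)) (index y (a :: p))) => [le|/ltnW le].
    exact: H.
  have ne' : y != x by rewrite eq_sym.
  by have [s1 [s2 [->|->]]] := H y x yp xp le ne' eyx exy; exists s1, s2; [right|left].
move=> ne exy _.
case/splitPl: xp up pp lp pmin yp ltxy ne exy => p1 p2 lx up pp lp pmin yp ltxy ne exy.
have yp2 : y \in p2.
  move: yp; rewrite -cat_cons mem_cat => /orP[yp1|//].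
  have : index y (a :: p1 ++ p2) <= index x (a :: p1 ++ p2).
    rewrite -cat_cons !index_cat yp1.
    have xp1 : x \in a :: p1 by rewrite -lx mem_last.
    have -> : index x (a :: p1) = size p1.
      rewrite -lx index_last //.
      by move: up; rewrite -cat_cons cat_uniq => /andP[].
    by rewrite xp1 -ltnS -[(size p1).+1]/(size (a :: p1)) index_mem.
  move=> le; have /eqP E : index x (a :: p1 ++ p2) == index y (a :: p1 ++ p2).
    by rewrite eqn_leq ltxy.
  have xp : x \in a :: p1 ++ p2 by rewrite -cat_cons mem_cat -lx mem_last.
  have yp : y \in a :: p1 ++ p2 by rewrite -cat_cons mem_cat yp1.
  by rewrite -(nth_index a xp) -(nth_index a yp) E eqxx in ne.
case/splitPr: yp2 up pp lp pmin {yp ltxy} => q1 q2 up pp lp pmin.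
(* The edge from [x] to [y] bypasses [q1], so minimality forces [q1] to be empty. *)
have q10 : q1 = [::].
  apply/nilP; rewrite /nilp.
  have := pmin (p1 ++ y :: q2); rewrite cat_path /= !last_cat /= !size_cat /= lx exy.
  move: pp lp; rewrite !cat_path /= !last_cat /= lx => /and3P[-> _ /andP[_ ->]] -> H.
  by have := H isT erefl; lia.
exists (belast a p1), q2; left; rewrite q10 /= -cat_cons (lastI a p1) lx.
by rewrite cat_rcons.
Qed.

End ShortestPaths.

(** * Distance and eccentricity as functions *)

Section Distance.
Variables (T : finType) (e : rel T).

(** A duplicate-free path has fewer than [#|T|] edges, so the bounded search misses no reachable
    vertex; an unreachable one gets [#|T|]. *)
Definition dist (u v : T) : nat :=
  find (fun k => [exists t : k.-tuple T, path e u t && (last u t == v)]) (iota 0 #|T|).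

Definition ecc (u : T) : nat := \max_v dist u v.

Hypotheses (e_sym : symmetric e) (e_conn : forall u v, connect e u v).

Lemma dist_le_path u p : path e u p -> dist u (last u p) <= size p.
Proof.
move=> pp; rewrite leqNgt; apply/negP => lt.
have szT : size p < #|T|.
  apply: leq_trans lt _; rewrite /dist -[leqRHS](size_iota 0); exact: find_size.
have := before_find 0 lt; rewrite nth_iota // add0n => /existsP[].
by exists (in_tuple p); rewrite pp eqxx.
Qed.

Lemma dist_pathP u v : exists p, [/\ path e u p, last u p = v & size p = dist u v].
Proof.
case/connectP: (e_conn u v) => p0 pp0 ->; case/shortenP: pp0 => p pp up _.
have szp : size p < #|T|.
  by have := card_uniqP up => /= <-; apply: max_card.
have hs : has (fun k => [exists t : k.-tuple T, path e u t && (last u t == last u p)])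
   (iota 0 #|T|).
  apply/hasP; exists (size p); first by rewrite mem_iota.
  by apply/existsP; exists (in_tuple p); rewrite pp eqxx.
have := nth_find 0 hs; rewrite has_find size_iota in hs.
rewrite nth_iota // add0n => /existsP[t /andP[pt /eqP lt]].
by exists t; split => //; rewrite size_tuple.
Qed.

Lemma dist0 u : dist u u = 0.
Proof. by apply/eqP; rewrite -leqn0; apply: (@dist_le_path u [::]). Qed.

Lemma dist_eq0 u v : dist u v = 0 -> u = v.
Proof. by have [[|? ?] [_ /= <- <-]] := dist_pathP u v. Qed.

Lemma dist_triangle v u w : dist u w <= dist u v + dist v w.
Proof.
have [p [pp lp <-]] := dist_pathP u v; have [q [pq <- <-]] := dist_pathP v w.
by rewrite -size_cat -lp -last_cat; apply: dist_le_path; rewrite cat_path pp lp.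
Qed.

Lemma dist_sym u v : dist u v = dist v u.
Proof.
suff {u v} H u v : dist u v <= dist v u by apply/eqP; rewrite eqn_leq !H.
have [p [pp lp <-]] := dist_pathP v u.
have pr : path e u (rev (belast v p)).
  by rewrite -lp rev_path (eq_path (e' := e)) // => x y; exact: e_sym.
have lr : last u (rev (belast v p)) = v.
  by case: p {pp pr} lp => [|x s] //= _; rewrite rev_cons last_rcons.
by have := dist_le_path pr; rewrite size_rev size_belast lr.
Qed.

Lemma dist_edge u v : e u v -> dist u v <= 1.
Proof. by move=> uv; apply: (@dist_le_path u [:: v]); rewrite /= uv. Qed.

Lemma dist_succ u v k : dist u v = k.+1 -> exists2 w, e u w & dist w v = k.
Proof.
have [[|w p] [/= pp lp szp]] := dist_pathP u v; first by rewrite -szp.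
case/andP: pp => uw pp dk; exists w => //.
by have := dist_triangle w u v; have := dist_edge uw; have := dist_le_path pp; rewrite lp; lia.
Qed.

Lemma dist1 u v : dist u v = 1 -> e u v.
Proof. by case/dist_succ => w uw /dist_eq0 wv; rewrite -wv. Qed.

Lemma dist_between u v k : k <= dist u v ->
  exists2 w, dist u w = k & dist w v = dist u v - k.
Proof.
elim: k => [|k IH] le; first by exists u; rewrite ?dist0 ?subn0.
have [w uw wv] := IH (ltnW le).
have [w' ww' w'v] : exists2 w', e w w' & dist w' v = dist u v - k.+1.
  by apply: dist_succ; lia.
exists w' => //; have := dist_triangle w u w'; have := dist_edge ww'.
by have := dist_triangle w' u v; lia.
Qed.

Lemma dist_edgeB r u v : e u v -> dist r v <= (dist r u).+1.
Proof. by move=> /dist_edge; have := dist_triangle u r v; lia. Qed.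

Lemma ecc_ge u v : dist u v <= ecc u.
Proof. exact: (@leq_bigmax _ (dist u)). Qed.

Lemma ecc_attained u : exists v, dist u v = ecc u.
Proof.
have [v _ vmax] := arg_maxnP (dist u) (isT : xpredT u).
exists v; apply/eqP; rewrite eqn_leq ecc_ge; apply/bigmax_leqP => w _; exact: vmax.
Qed.

End Distance.

Lemma next_split (T : eqType) (s1 s2 : seq T) x y :
  uniq (s1 ++ x :: y :: s2) -> next (s1 ++ x :: y :: s2) x = y.
Proof.
move=> us; rewrite next_nth mem_cat mem_head orbT.
have : x \notin s1 by move: us; rewrite cat_uniq /= negb_or => /and3P[_ /andP[]].
case: s1 us => [|z s1] us /= xs; first by rewrite eqxx.
move: xs; rewrite in_cons negb_or eq_sym => /andP[/negPf-> xs].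
rewrite index_cat (negPf xs) /= eqxx addn0 -[_.+1]addn1 nth_cat.
by rewrite ltnNge leq_addr /= addKn.
Qed.

(** * Level cliques and near-central vertices in chordal graphs *)

Section Chordal.
Variables (n : nat) (e : rel 'I_n).
Hypotheses (e_sym : symmetric e) (e_conn : gconnected e) (e_chordal : chordal e).
Local Notation d := (dist e).

(** An arc on which only consecutive vertices are adjacent cannot contain both ends of a chord of
    the cycle. In [level_clique] this is applied to each of the two arcs, after rotating the cycle
    for the second. *)
Lemma no_chord (a b : 'I_n) (U V : seq 'I_n) x y :
  uniq ((a :: U) ++ b :: V) ->
  (forall x y, x \in a :: rcons U b -> y \in a :: rcons U b -> x != y ->
     e x y -> exists s1 s2,
     a :: rcons U b = s1 ++ x :: y :: s2 \/ a :: rcons U b = s1 ++ y :: x :: s2) ->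
  x \in a :: rcons U b -> y \in a :: rcons U b ->
  [&& x != y, y != next ((a :: U) ++ b :: V) x, x != next ((a :: U) ++ b :: V) y & e x y] -> False.
Proof.
move=> uc ind xp yp /and4P[ne nx ny exy].
have Ec : (a :: U) ++ b :: V = (a :: rcons U b) ++ V by rewrite /= cat_rcons.
have [s1 [s2 [E|E]]] := ind x y xp yp ne exy; move: nx ny uc; rewrite Ec E -catA /=.
  by move=> nx _ uc; rewrite next_split // eqxx in nx.
by move=> _ nx uc; rewrite next_split // eqxx in nx.
Qed.

Lemma level_clique (r a b : 'I_n) q (up : pred 'I_n) :
  up =1 (fun x => [|| q < d r x, x == a | x == b]) ->
  d r a = q -> d r b = q ->
  connect (fun x z => [&& e x z, up x & up z]) a b -> d a b <= 1.
Proof.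
move=> upE da db cU; have [->|neab] := eqVneq a b; first by rewrite dist0.
case: (boolP (e a b)) => [/(dist_edge (e:=e))//|nab]; exfalso.
(* The lower region meets the upper one only in [a] and [b], and it is connected through the root
   because geodesics to [r] descend in it. *)
pose lo x := [|| d r x < q, x == a | x == b].
pose rU x z := [&& e x z, up x & up z]; pose rL x z := [&& e x z, lo x & lo z].
have rL_sym : connect_sym rL.
  by apply: sym_connect_sym => x z; rewrite /rL e_sym [lo x && _]andbC.
have cL0 x : lo x -> connect rL r x.
  move=> lox.
  have [k] := ubnP (d r x); elim: k x lox => // k IH x lox /ltnSE le.
  case E: (d r x) => [|l]; first by rewrite (dist_eq0 e_conn E) connect0.
  rewrite (dist_sym e_sym e_conn) in E; case: (dist_succ e_conn E) => w exw dw.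
  rewrite (dist_sym e_sym e_conn) in E; rewrite (dist_sym e_sym e_conn) in dw.
  have low : lo w.
    rewrite /lo dw; move: lox; rewrite /lo E => /or3P[|/eqP xa|/eqP xb]; first by move/ltnW->.
      by rewrite -da -xa E ltnSn.
    by rewrite -db -xb E ltnSn.
  apply: connect_trans (IH w low _) (connect1 _); first by rewrite dw -E.
  by rewrite /rL e_sym exw low lox.
have loa : lo a by rewrite /lo eqxx orbT.
have lob : lo b by rewrite /lo eqxx !orbT.
have cL : connect rL b a.
  by apply: connect_trans (cL0 a loa); rewrite rL_sym; apply: cL0.
have mono (r1 r2 : rel 'I_n) (x : 'I_n) p : subrel r1 r2 -> path r1 x p -> path r2 x p.
  by move=> sub; apply: sub_path.
have upP x p : path rU x p -> up x -> {in x :: p, forall z, up z}.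
  elim: p x => [|y p IH] x /=; first by move=> _ ux z; rewrite inE => /eqP->.
  case/andP=> /and3P[_ _ uy] pp ux z; rewrite inE => /predU1P[->//|]; exact: IH.
have loP x p : path rL x p -> lo x -> {in x :: p, forall z, lo z}.
  elim: p x => [|y p IH] x /=; first by move=> _ ux z; rewrite inE => /eqP->.
  case/andP=> /and3P[_ _ uy] pp ux z; rewrite inE => /predU1P[->//|]; exact: IH.
have [pU [ppU lU uU indU]] := induced_path cU.
have [pL [ppL lL uL indL]] := induced_path cL.
have upa : up a by rewrite upE eqxx orbT.
have upU := upP _ _ ppU upa; have loL := loP _ _ ppL lob.
have eU : path e a pU by apply: mono ppU => x z /and3P[].
have eL : path e b pL by apply: mono ppL => x z /and3P[].
case/lastP: pU lU ppU uU indU upU eU => [/eqP|U b' lU]; first by rewrite (negPf neab).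
rewrite last_rcons in lU; rewrite {b'}lU => ppU uU indU upU eU.
case/lastP: pL lL ppL uL indL loL eL => [/esym/eqP|V a' lV]; first by rewrite (negPf neab).
rewrite last_rcons in lV; rewrite {a'}lV => ppL uL indL loL eL.
(* Non-adjacency of [a] and [b] gives both arcs an inner vertex, so the cycle has length at least
   4. *)
case: U ppU uU indU upU eU => [_ _ _ _|u0 U]; first by rewrite /= andbT (negPf nab).
move: (u0 :: U) (isT : 0 < size (u0 :: U)) => {u0}U szU ppU uU indU upU eU.
case: V ppL uL indL loL eL => [_ _ _ _|v0 V]; first by rewrite /= andbT e_sym (negPf nab).
move: (v0 :: V) (isT : 0 < size (v0 :: V)) => {v0}V szV ppL uL indL loL eL.
pose c := (a :: U) ++ b :: V.
have uc : uniq c.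
  rewrite /c cat_uniq; move: uU uL; rewrite -rcons_cons rcons_uniq -[b :: rcons _ _]rcons_cons.
  rewrite rcons_uniq => /andP[bU ->] /andP[aV ->]; rewrite andbT -all_predC.
  apply/allP => x xV /=; apply/negP => xU.
  have xL : lo x by apply: loL; rewrite -rcons_cons mem_rcons inE xV orbT.
  have xup : up x by apply: upU; rewrite -rcons_cons mem_rcons inE xU orbT.
  move: xup xL; rewrite upE /lo => /or3P[lt|/eqP xa|/eqP xb].
  - rewrite ltnNge (ltnW lt) /= => /orP[]/eqP E; move: lt; rewrite E ?da ?db ltnn //.
  - by rewrite -xa xV in aV.
  - by rewrite -xb xU in bU.
have cc : cycle e c.
  by rewrite /c /= rcons_cat /= -cat_rcons cat_path eU last_rcons.
have szc : 4 <= size c by rewrite /c size_cat /= addSn addnS !ltnS (leq_add szU szV).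
have [x [y /and5P[xc yc ne nx /andP[ny exy]]]] := e_chordal uc szc cc.
have uc' : uniq ((b :: V) ++ a :: U) by rewrite uniq_catC.
have Enext : next c =1 next ((b :: V) ++ a :: U).
  by move=> z; rewrite -(next_rot (size (a :: U)) uc) /c rot_size_cat.
have memU z : z \in c -> up z -> z \in a :: rcons U b.
  rewrite /c mem_cat -rcons_cons mem_rcons in_cons => /orP[->|zV] uz; first by rewrite orbT.
  have zL : lo z by apply: loL; rewrite -rcons_cons mem_rcons inE zV orbT.
  move: uz zL; rewrite upE /lo !inE => /or3P[lt|->|->]; rewrite ?orbT //.
  by rewrite ltnNge (ltnW lt) /= => /orP[]->; rewrite ?orbT.
have memL z : z \in c -> lo z -> z \in b :: rcons V a.
  rewrite /c mem_cat -rcons_cons mem_rcons in_cons => /orP[zU|->] uz; last by rewrite orbT.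
  have zL : up z by apply: upU; rewrite -rcons_cons mem_rcons inE zU orbT.
  move: zL uz; rewrite upE /lo !inE => /or3P[lt|->|->]; rewrite ?orbT //.
  by rewrite ltnNge (ltnW lt) /= => /orP[]->; rewrite ?orbT.
have cU' z : z \in c -> up z || lo z.
  rewrite /c mem_cat => /orP[zU|zV].
    by rewrite upU // -rcons_cons mem_rcons inE zU orbT.
  by rewrite orbC loL // -rcons_cons mem_rcons inE zV orbT.
case: (boolP (up x && up y)) => [/andP[ux uy]|nup].
  apply: (@no_chord a b U V x y uc).
  - move=> x' y' xp yp ne' exy'; apply: indU => //.
      by rewrite /rU exy' !upU.
    by rewrite /rU e_sym exy' !upU.
  - exact: memU.
  - exact: memU.
  - by rewrite ne nx ny.
case: (boolP (lo x && lo y)) => [/andP[lx ly]|nlo].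
  apply: (@no_chord b a V U x y uc').
  - move=> x' y' xp yp ne' exy'; apply: indL => //.
      by rewrite /rL exy' !loL.
    by rewrite /rL e_sym exy' !loL.
  - exact: memL.
  - exact: memL.
  - by rewrite -!Enext ne nx ny.
(* A chord cannot join inner vertices of different arcs: their levels are above and below [q], and
   an edge changes the level by at most 1. *)
have gap z t : e z t -> up z -> ~~ lo z -> lo t -> ~~ up t -> False.
  move=> ezt; rewrite !upE /lo !negb_or => upz /and3P[nz za zb] lot /and3P[nt ta tb].
  have etz : e t z by rewrite e_sym.
  move: upz lot (dist_edgeB e_conn r etz).
  by rewrite (negPf za) (negPf zb) (negPf ta) (negPf tb) !orbF; clear; lia.
have := cU' x xc; have := cU' y yc; move: nup nlo.
case ux: (up x); case lx: (lo x); case uy: (up y); case ly: (lo y) => // _ _ _ _.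
  by apply: (gap x y exy); rewrite ?ux ?lx ?uy ?ly.
have eyx : e y x by rewrite e_sym.
by apply: (gap y x eyx); rewrite ?ux ?lx ?uy ?ly.
Qed.

(** [connect] over this relation gives the components of the subgraph on levels at least [i]; a
    vertex of lower level is linked only to itself. *)
Definition above (r : 'I_n) i : rel 'I_n := fun x z => [&& e x z, i <= d r x & i <= d r z].

Let d_sym u v : d u v = d v u. Proof. exact: dist_sym. Qed.

Lemma above_sym r i : connect_sym (above r i).
Proof. by apply: sym_connect_sym => x z; rewrite /above e_sym [(_ <= _) && _]andbC. Qed.

Lemma above_level r i u w : connect (above r i) u w -> i <= d r u -> i <= d r w.
Proof.
case/connectP=> p pp ->; elim: p u pp => //= x p IH u /andP[/and3P[_ _ ix] pp] _.
exact: IH.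
Qed.

(** The geodesics from [a] to [u] and from [b] to [w] rise from level [q] at once; with the link
    between [u] and [w] they form the upper path that [level_clique] asks for. Taking [u = w] shows
    that a slice is a clique. *)
Lemma slice_clique r q u w a b :
  connect (above r q.+1) u w -> q < d r u -> d r a = q -> d r b = q ->
  d r u = q + d a u -> d r w = q + d b w -> d a b <= 1.
Proof.
move=> cuw lu da db dau dbw; have lw := above_level cuw lu.
pose up x := [|| q < d r x, x == a | x == b].
pose rU x z := [&& e x z, up x & up z].
have descend x v : up x -> d r v = d r x + d x v -> q <= d r x -> connect rU x v.
  have [k] := ubnP (d x v); elim: k x => // k IH x /ltnSE le ux dv qx.
  case E: (d x v) => [|l]; first by rewrite (dist_eq0 e_conn E) connect0.
  have [z exz dz] := dist_succ e_conn E.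
  have lz : d r z = (d r x).+1.
    have := dist_edgeB e_conn r exz; have := dist_triangle e_conn z r v.
    by rewrite dv E dz; lia.
  have uz : up z by rewrite /up lz ltnS qx.
  apply: connect_trans (connect1 _) (IH z _ uz _ _); rewrite ?lz.
  - by rewrite /rU exz ux uz.
  - by rewrite dz -E; lia.
  - by rewrite dz dv E; lia.
  - exact: leqW.
have rU_sym : connect_sym rU.
  by apply: sym_connect_sym => x z; rewrite /rU e_sym [up x && _]andbC.
apply: (@level_clique r a b q up) => //.
apply: connect_trans (descend a u _ _ _) _; rewrite ?da ?/up ?eqxx ?orbT //.
apply: (@connect_trans _ _ w).
  apply: connect_sub cuw => x z /and3P[exz lx lz].
  by apply: connect1; rewrite /rU /up exz lx lz.
by rewrite rU_sym; apply: descend; rewrite ?db ?/up ?eqxx ?orbT.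
Qed.

(** A geodesic from [u] to [w] has to drop to level [q]; [a] is its first vertex there and [x] the
    one before. Keeping [x] makes [slice_clique] applicable to [a]. *)
Lemma separator r q u w : q < d r u -> ~~ connect (above r q.+1) u w ->
  exists x a, [/\ connect (above r q.+1) u x, e x a, d r a = q & d u w = d u a + d a w].
Proof.
have [k] := ubnP (d u w); elim: k u => // k IH u /ltnSE le lu nc.
case E: (d u w) => [|l]; first by rewrite (dist_eq0 e_conn E) connect0 in nc.
have [v euv dv] := dist_succ e_conn E.
have [lv|lv] := ltnP q (d r v).
  have auv : above r q.+1 u v by rewrite /above euv lu lv.
  have nv : ~~ connect (above r q.+1) v w.
    by apply: contra nc; apply: connect_trans; apply: connect1.
  have lek : d v w < k by rewrite dv -E.
  have [x [a [cx exa la da]]] := IH v lek lv nv.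
  exists x, a; split=> //; first exact: connect_trans (connect1 auv) cx.
  have := dist_triangle e_conn v u a; have := dist_triangle e_conn a u w.
  by have := dist_edge euv; rewrite E -dv; lia.
exists u, v; split=> //.
  have evu : e v u by rewrite e_sym.
  by have := dist_edgeB e_conn r evu; lia.
have := dist_triangle e_conn v u w; have := dist_edge euv.
by rewrite E dv; lia.
Qed.

(* [y] is farthest from [s]; if the two were separated near the root [y], a
   geodesic from [s] to [w] would be longer than [ecc e s]. *)
Lemma farthest_linked s y w i : d s y = ecc e s -> 2 * i < d y w ->
  connect (above y i.+1) s w.
Proof.
move=> dsy lt; apply: contraT => nc.
have [x lx dx] : exists2 x, d y x <= i & d s w = d s x + d x w.
  have [lts|le] := ltnP i (d y s).
    by have [_ [a [_ _ la da]]] := separator lts nc; exists a; rewrite ?la.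
  by exists s; rewrite ?dist0.
have := ecc_ge e s w; rewrite -dsy dx.
have := dist_triangle e_conn x s y; have := dist_triangle e_conn x y w.
by rewrite [d x y]d_sym; lia.
Qed.

Lemma exists_middle s y : d s y = ecc e s ->
  exists2 c, d s c + d c y = d s y & 2 * d y c - ecc e y <= 1 /\ ecc e y <= 2 * d y c.
Proof.
(* Half of [ecc e y] is rounded up, so that [2 * j] exceeds it by at most 1. *)
move=> dsy; pose j := uphalf (ecc e y).
have jE : 2 * j - ecc e y <= 1 /\ ecc e y <= 2 * j.
  have := odd_double_half (ecc e y); rewrite /j uphalf_half.
  by case: odd => /=; rewrite -mul2n; lia.
(* A vertex farthest from [y] is linked to [s] on levels at least [j], which forces [s] itself up to
   that level. *)
have jle : j <= d y s.
  have [z dz] := ecc_attained e y.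
  have [|lt] := leqP j 0; first by lia.
  have lt2 : 2 * j.-1 < d y z by rewrite dz; lia.
  have lk := farthest_linked dsy lt2; rewrite prednK // in lk.
  by apply: (above_level (i := j) (u := z)); [rewrite above_sym; exact: lk|rewrite dz; lia].
have [c dyc dcs] := dist_between e_conn jle.
exists c; last by rewrite dyc.
by rewrite d_sym dcs [d c y]d_sym dyc [d s y]d_sym subnK.
Qed.

(** Every [x] has [ecc e x >= d y c], by the triangle inequality at a vertex farthest from [y], so
    it suffices that [c] reaches everything within [d y c + 3]. The geodesics from [y] to [c] and to
    [w] are at distance at most 1 on a level [i] just below half of [d y w]; of the 3, one is this
    edge and two come from rounding [i]. *)
Lemma middle_ecc s y c : d s y = ecc e s -> d s c + d c y = d s y ->
  2 * d y c - ecc e y <= 1 -> ecc e y <= 2 * d y c ->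
  forall x, ecc e c <= ecc e x + 3.
Proof.
move=> dsy dsc le1 le2 x.
have jx : d y c <= ecc e x.
  have [z dz] := ecc_attained e y; rewrite -dz in le1 le2.
  have := ecc_ge e x y; have := ecc_ge e x z.
  by have := dist_triangle e_conn x y z; rewrite [d y x]d_sym; lia.
suff : forall w, d c w <= d y c + 3.
  by have [w <-] := ecc_attained e c; move=> /(_ w); lia.
move=> w; case E: (d y w) => [|l].
  by rewrite -(dist_eq0 e_conn E) d_sym; lia.
pose i := l./2.
have il : 2 * i < d y w /\ d y w <= 2 * i + 2.
  rewrite E; have := odd_double_half l; rewrite /i -mul2n.
  by case: odd => /=; lia.
have lk := farthest_linked dsy il.1.
have lw := ecc_ge e y w.
have ic : i < d y c by lia.
have [a dya dac] := dist_between e_conn (ltnW ic).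
have [b dyb dbw] : exists2 b, d y b = i & d b w = d y w - i.
  by apply: dist_between => //; lia.
have dysc : d y s = d y c + d c s by rewrite d_sym -dsc addnC [d c y]d_sym [d s c]d_sym.
have das : d y s = i + d a s.
  have := dist_triangle e_conn c a s; have := dist_triangle e_conn a y s.
  by rewrite dya dac; lia.
have ab : d a b <= 1.
  by apply: (slice_clique lk _ dya dyb das); rewrite ?dbw; lia.
have := dist_triangle e_conn a c w; have := dist_triangle e_conn b a w.
by rewrite [d c a]d_sym dac dbw; lia.
Qed.

(** * Vertices with the same slice have the same [ecc v - d(c, v)] *)

Section Classes.
Variable c : 'I_n.
Hypothesis c_central : forall x, ecc e c <= ecc e x + 3.

(* The proof needs [k > 5]: 3 is lost in [c_central] and 1 in each of two cliques. *)
Let k := 6.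

(** The first level-[k] vertex [a] of a geodesic to [w] need not lie in the slice of [v], but it is
    equal or adjacent to a vertex [b] that does. If [a] misses the slice it is one farther from [v]
    than [b], so the route through [b] is as short. At level [k] the slice is [v] alone, hence the
    guarded hypothesis. *)
Lemma through_slice v w : k <= d c v -> (k < d c v -> ~~ connect (above c k.+1) v w) ->
  exists a, [/\ d c a = k, d c v = k + d a v & d v w = d v a + d a w].
Proof.
rewrite leq_eqVlt => /predU1P[lv|lt] nc; first by exists v; rewrite -lv dist0 addn0.
have [x [a [cx exa la da]]] := separator lt (nc lt).
have [b lb db] := dist_between e_conn (ltnW lt).
have dax : d c x = k + d a x.
  have lx := above_level cx lt; have eax : e a x by rewrite e_sym.
  have := dist_edgeB e_conn c eax; have := dist_edge eax.
  by have := dist_triangle e_conn a c x; rewrite la; lia.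
have ba : d b a <= 1 by apply: (slice_clique cx lt lb la _ dax); lia.
have [E|ne] := eqVneq (d a v) (d b v).
  by exists a; rewrite la E db; split=> //; lia.
exists b; rewrite lb db; split=> //; first by lia.
have := dist_triangle e_conn a c v; have := dist_triangle e_conn b v w.
have := dist_triangle e_conn a b w.
by rewrite da [d v b]d_sym [d v a]d_sym la; lia.
Qed.

(* Vertices behind the same level-[k] slice are too close to be farthest. *)
Lemma behind_slice_close v a w : connect (above c k.+1) v w -> k < d c v ->
  d c a = k -> d c v = k + d a v -> d a w + k <= (ecc e c).+1.
Proof.
move=> cvw lv la da; have lw := above_level cvw lv.
have [b lb db] := dist_between e_conn (ltnW lw).
have ab : d a b <= 1 by apply: (slice_clique cvw lv la lb da); lia.
have := ecc_ge e c w; have := dist_triangle e_conn b a w; lia.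
Qed.

Lemma slice_clique1 v a b : d c a = k -> d c b = k ->
  d c v = k + d a v -> d c v = k + d b v -> d a b <= 1.
Proof.
move=> la lb da db.
have [lt|] := ltnP k (d c v); first exact: slice_clique (connect0 _ v) lt la lb da db.
rewrite da -[leqRHS]addn0 leq_add2l leqn0 => /eqP E; move: db.
rewrite da E => /eqP; rewrite eqn_add2l eq_sym => /eqP Eb.
by rewrite (dist_eq0 e_conn E) (dist_eq0 e_conn Eb) dist0.
Qed.

(** The witness is [a] itself. A vertex farthest from [a] is not behind the slice, since
    [ecc e a + 6 <= ecc e c + 1] would contradict [c_central]; a geodesic from [v] to it thus
    crosses the slice, at distance at most 1 from [a]. *)
Lemma ecc_lower_bound v a : k <= d c v -> d c a = k -> d c v = k + d a v ->
  exists x, d a v + ecc e x <= (ecc e v).+1.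
Proof.
move=> lv la da; have [w dw] := ecc_attained e a; exists a.
have nc : k < d c v -> ~~ connect (above c k.+1) v w.
  move=> lt; apply/negP => cvw; have := behind_slice_close cvw lt la da.
  by have := c_central a; rewrite dw /k; lia.
have [b [lb db dvw]] := through_slice lv nc.
have := slice_clique1 la lb da db; have := ecc_ge e v w.
have := dist_triangle e_conn b a w; rewrite dvw dw [d v b]d_sym; lia.
Qed.

Lemma ecc_class_le v v' : k <= d c v -> k <= d c v' ->
  (forall a, d c a = k -> d c v = k + d a v <-> d c v' = k + d a v') ->
  ecc e v + d c v' <= ecc e v' + d c v.
Proof.
move=> lv lv' same; have [u du] := ecc_attained e v; rewrite -du.
(* If [u] were behind the slice, its distance to [v] would be at most [d a v + ecc e c - 5], hence
   at most [d a v + ecc e x - 2], below the lower bound [d a v + ecc e x - 1] for [ecc e v]. *)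
have nc : k < d c v' -> ~~ connect (above c k.+1) v' u.
  move=> lt; apply/negP => cvu.
  have [a la da] := dist_between e_conn lv.
  have Ea : d c v = k + d a v by rewrite da; lia.
  have Ea' := (same a la).1 Ea; have := behind_slice_close cvu lt la Ea'.
  have [x] := ecc_lower_bound lv la Ea; have := c_central x.
  by have := dist_triangle e_conn a v u; rewrite du [d v a]d_sym /k; lia.
have [a [la da dvu]] := through_slice lv' nc; have Ea := (same a la).2 da.
have := ecc_ge e v' u; have := dist_triangle e_conn a v u.
by rewrite dvu [d v a]d_sym [d v' a]d_sym; lia.
Qed.

(** Testing the whole ball, not only its boundary, also separates the vertices within it: a vertex
    at distance less than [k] is between [c] and itself, so it shares its pattern with no other
    vertex. *)
Lemma ecc_class v v' :
  (forall a, d c a <= k -> (d c a + d a v == d c v) = (d c a + d a v' == d c v')) ->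
  ecc e v + d c v' = ecc e v' + d c v.
Proof.
move=> same; have short x x' : (forall a, d c a <= k ->
    (d c a + d a x == d c x) = (d c a + d a x' == d c x')) -> d c x < k -> x = x'.
  move=> sm lt; have := sm x (ltnW lt); rewrite dist0 addn0 eqxx => /esym/eqP E.
  have [le'|lt'] := leqP (d c x') k.
    have := sm x' le'; rewrite dist0 addn0 eqxx => /eqP E'.
    rewrite [d x' x]d_sym in E'.
    by apply: (dist_eq0 e_conn); lia.
  have [a la da] := dist_between e_conn (ltnW lt').
  have := sm a; rewrite la leqnn => /(_ isT).
  by rewrite da subnKC ?eqxx ?(ltnW lt') // => /eqP Ea; lia.
have [kv|lt] := leqP k (d c v); last by rewrite -(short v v').
have [kv'|lt] := leqP k (d c v'); last by rewrite (short v' v) // => a la; rewrite same.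
have slices a : d c a = k -> d c v = k + d a v <-> d c v' = k + d a v'.
  move=> la; have := same a; rewrite la leqnn => /(_ isT) Eb.
  by split=> H; apply/esym/eqP; move: Eb; rewrite -H eqxx => // <-.
apply/eqP; rewrite eqn_leq !ecc_class_le // => a la.
by split=> /(slices a la).
Qed.

End Classes.
End Chordal.

(** * Ball size, edge count and the specification of eccentricity *)

Section Counting.
Variables (n : nat) (e : rel 'I_n).
Hypotheses (e_sym : symmetric e) (e_conn : gconnected e).

Lemma ball_card (D k : nat) (c : 'I_n) : (forall v, degree e v <= D) ->
  #|[set x | dist e c x <= k]| <= D.+1 ^ k.
Proof.
move=> deg; elim: k => [|k IH].
  apply: (@leq_trans #|[set c]|); last by rewrite cards1.
  apply: subset_leq_card; apply/subsetP => x.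
  by rewrite !inE leqn0 => /eqP/(dist_eq0 e_conn) ->.
pose B := [set x | dist e c x <= k].
have sub : [set x | dist e c x <= k.+1] \subset \bigcup_(x in B) (x |: [set u | e x u]).
  apply/subsetP => x; rewrite inE leq_eqVlt => /predU1P[E|lt]; last first.
    by apply/bigcupP; exists x; rewrite ?inE ?eqxx.
  rewrite (dist_sym e_sym e_conn) in E; have [w exw dw] := dist_succ e_conn E.
  apply/bigcupP; exists w; first by rewrite inE (dist_sym e_sym e_conn) dw.
  by rewrite !inE e_sym exw orbT.
apply: leq_trans (subset_leq_card sub) _.
have cardU : #|\bigcup_(x in B) (x |: [set u | e x u])| <= \sum_(x in B) D.+1.
  apply: (@leq_trans (\sum_(x in B) #|x |: [set u | e x u]|)).
    elim/big_rec2: _ => [|x m S _ le]; first by rewrite cards0.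
    by rewrite cardsU; apply: leq_trans (leq_subr _ _) _; rewrite leq_add2l.
  apply: leq_sum => x _; rewrite cardsU1 -addn1 addnC leq_add ?deg //.
  by case: (_ \in _).
by apply: leq_trans cardU _; rewrite sum_nat_const expnS mulnC leq_mul2l IH orbT.
Qed.

(** Each vertex other than the root is sent to its edge towards a neighbour closer to the root. If
    two vertices had the same edge, each would be closer than the other, so the map is injective. *)
Lemma connected_nedges : n <= (nedges e).+1.
Proof.
case: n e e_sym e_conn => [//|m] f f_sym f_conn.
pose par v := odflt v [pick w | f v w && (dist f ord0 w < dist f ord0 v)].
have parP v : v != ord0 -> f v (par v) && (dist f ord0 (par v) < dist f ord0 v).
  move=> nz; rewrite /par; case: pickP => [w //|none].
  have [E0|[l E]] : dist f v ord0 = 0 \/ exists l, dist f v ord0 = l.+1.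
  - by case: dist => [|l]; [left|right; exists l].
  - by rewrite (dist_eq0 f_conn E0) eqxx in nz.
  have [w fvw dw] := dist_succ f_conn E.
  have := none w; rewrite fvw (dist_sym f_sym f_conn ord0 w) (dist_sym f_sym f_conn ord0 v).
  by rewrite dw E ltnSn.
pose edge (v : 'I_m.+1) := if v < par v then (v, par v) else (par v, v).
have mE : m = #|[set v : 'I_m.+1 | v != ord0]|.
  have := cardsC [set ord0 : 'I_m.+1]; rewrite cards1 card_ord add1n => -[E].
  by rewrite -[LHS]E; apply: eq_card => x; rewrite !inE.
have edge_inj : {in [set v : 'I_m.+1 | v != ord0] &, injective edge}.
  move=> v w; rewrite !inE => /parP/andP[_ ltv] /parP/andP[_ ltw].
  rewrite /edge; case: ifP => _; case: ifP => _ [] // E1 E2.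
    by move: ltv; rewrite E2 E1 ltnNge (ltnW ltw).
  by move: ltv; rewrite E1 E2 ltnNge (ltnW ltw).
rewrite ltnS; apply: (@leq_trans #|edge @: [set v : 'I_m.+1 | v != ord0]|).
  by rewrite card_in_imset // -mE.
apply: subset_leq_card; apply/subsetP => p /imsetP[v + ->]; rewrite inE => /parP/andP[fv lt].
rewrite inE /edge; case: (ltngtP v (par v)) => [vp|pv|E] /=; first by rewrite vp fv.
  by rewrite pv f_sym.
by rewrite -(val_inj E) ltnn in lt.
Qed.

Lemma is_dist_dist u v : is_dist e u v (dist e u v).
Proof. by split=> [|p pp <-]; [exact: dist_pathP|exact: dist_le_path]. Qed.

Lemma is_ecc_ecc u : is_ecc e u (ecc e u).
Proof.
split=> [|v k [[p [pp lp <-]] kmin]].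
  by have [v <-] := ecc_attained e u; exists v; exact: is_dist_dist.
apply: leq_trans (ecc_ge e u v); have [q [pq lq <-]] := dist_pathP e_conn u v.
exact: kmin.
Qed.

End Counting.

(** * Structured programs for the machine *)

Local Notation memory := (nat -> nat) (only parsing).

Definition pstep (m : memory) (i : instr) : memory :=
  match i with
  | IConst r k => upd m r k
  | IAdd r a b => upd m r (m a + m b)
  | ISub r a b => upd m r (m a - m b)
  | ILoad r a => upd m r (m (m a))
  | IStore a b => upd m (m a) (m b)
  | _ => m
  end.

Definition prim (i : instr) : bool :=
  match i with IJz _ _ | IJmp _ | IHalt => false | _ => true end.

Definition psteps : memory -> seq instr -> memory := foldl pstep.

Inductive rcmd :=
  | RPrims of seq instr
  | RSeq of rcmd & rcmd
  | RIf of nat & rcmd & rcmd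
  | RWhile of nat & rcmd.

Fixpoint rwf (c : rcmd) : bool :=
  match c with
  | RPrims l => all prim l
  | RSeq a b | RIf _ a b => rwf a && rwf b
  | RWhile _ a => rwf a
  end.

Fixpoint rsize (c : rcmd) : nat :=
  match c with
  | RPrims l => size l
  | RSeq a b => rsize a + rsize b
  | RIf _ a b => rsize a + rsize b + 2
  | RWhile _ a => rsize a + 2
  end.

Fixpoint code (pc : nat) (c : rcmd) : seq instr :=
  match c with
  | RPrims l => l
  | RSeq a b => code pc a ++ code (pc + rsize a) b
  | RIf r a b =>
      IJz r (pc + rsize a + 2) :: code pc.+1 a ++
      IJmp (pc + rsize a + rsize b + 2) :: code (pc + rsize a + 2) b
  | RWhile r a => IJz r (pc + rsize a + 2) :: code pc.+1 a ++ [:: IJmp pc]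
  end.

Inductive reval : rcmd -> memory -> nat -> memory -> Prop :=
  | RevPrims l m : reval (RPrims l) m (size l) (psteps m l)
  | RevSeq a b m t m' t' m'' :
      reval a m t m' -> reval b m' t' m'' -> reval (RSeq a b) m (t + t') m''
  | RevIfN r a b m t m' :
      m r != 0 -> reval a m t m' -> reval (RIf r a b) m t.+2 m'
  | RevIfZ r a b m t m' :
      m r = 0 -> reval b m t m' -> reval (RIf r a b) m t.+1 m'
  | RevWhileZ r a m : m r = 0 -> reval (RWhile r a) m 1 m
  | RevWhileN r a m t m' t' m'' :
      m r != 0 -> reval a m t m' -> reval (RWhile r a) m' t' m'' ->
      reval (RWhile r a) m (t + t').+2 m''.

Lemma size_code pc c : size (code pc c) = rsize c.
Proof.
elim: c pc => //= [a IHa b IHb|r a IHa b IHb|r a IHa] pc.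
- by rewrite size_cat IHa IHb.
- by rewrite size_cat /= IHa IHb; lia.
- by rewrite size_cat /= IHa; lia.
Qed.

Lemma exec_prims l P1 P2 m f : all prim l ->
  exec (P1 ++ l ++ P2) (size l + f) (size P1) m =
  exec (P1 ++ l ++ P2) f (size P1 + size l) (psteps m l).
Proof.
elim: l P1 m => [|i l IH] P1 m /=; first by rewrite addn0.
case/andP=> pi pl.
have E : P1 ++ i :: l ++ P2 = rcons P1 i ++ l ++ P2 by rewrite cat_rcons.
have N : nth IHalt (P1 ++ i :: l ++ P2) (size P1) = i by rewrite nth_cat ltnn subnn.
have := IH (rcons P1 i) (pstep m i) pl; rewrite -E size_rcons addSnnS => <-.
by rewrite N; case: i pi {E N}.
Qed.

Lemma exec_jz P f pc m r l : nth IHalt P pc = IJz r l ->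
  exec P f.+1 pc m = exec P f (if m r == 0 then l else pc.+1) m.
Proof. by move=> /= ->. Qed.

Lemma exec_jmp P f pc m l : nth IHalt P pc = IJmp l ->
  exec P f.+1 pc m = exec P f l m.
Proof. by move=> /= ->. Qed.

Lemma nth_pivot_at (T : Type) (x0 : T) P1 i P2 k : k = size P1 ->
  nth x0 (P1 ++ i :: P2) k = i.
Proof. by move=> ->; rewrite nth_cat ltnn subnn. Qed.

Lemma nth_pivot (T : Type) (x0 : T) P1 i P2 : nth x0 (P1 ++ i :: P2) (size P1) = i.
Proof. exact: nth_pivot_at. Qed.

(** The code stands between arbitrary [P1] and [P2], since jump targets are absolute, and arbitrary
    fuel [f] is left over; sequencing and loops require both of the induction. *)
Lemma exec_code c m t m' : reval c m t m' -> rwf c -> forall P1 P2 f,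
  exec (P1 ++ code (size P1) c ++ P2) (t + f) (size P1) m =
  exec (P1 ++ code (size P1) c ++ P2) f (size P1 + rsize c) m'.
Proof.
elim=> {c m t m'}.
- by move=> l m pl P1 P2 f; exact: exec_prims.
- move=> a b m t m' t' m'' _ IHa _ IHb /andP[wa wb] P1 P2 f; cbn [code rsize].
  rewrite -!catA -addnA IHa //.
  have := IHb wb (P1 ++ code (size P1) a) P2 f.
  by rewrite -!catA size_cat size_code addnA.
- move=> r a b m t m' nz _ IHa /andP[wa wb] P1 P2 f; cbn [code rsize].
  set J := IJz _ _; set L := IJmp _; set cb := code _ b; set P := P1 ++ _.
  have E1 : P = rcons P1 J ++ code (size (rcons P1 J)) a ++ L :: cb ++ P2.
    by rewrite size_rcons cat_rcons /P /= -catA.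
  have E2 : P = (rcons P1 J ++ code (size (rcons P1 J)) a) ++ L :: cb ++ P2.
    by rewrite E1 -catA.
  rewrite addSn (@exec_jz _ _ _ _ r _ (nth_pivot _ _ _ _)) (negPf nz) addSnnS.
  have := IHa wa (rcons P1 J) (L :: cb ++ P2) f.+1; rewrite -E1 size_rcons => ->.
  rewrite (@exec_jmp _ _ _ _ (size P1 + rsize a + rsize b + 2)).
    by congr (exec _ _ _ _); lia.
  by rewrite E2 nth_pivot_at // size_cat size_code size_rcons.
- move=> r a b m t m' z _ IHb /andP[wa wb] P1 P2 f; cbn [code rsize].
  set J := IJz _ _; set L := IJmp _.
  have := IHb wb (P1 ++ J :: code (size P1).+1 a ++ [:: L]) P2 f.
  rewrite !size_cat [size (J :: _)]/= size_cat size_code [size [:: L]]/=.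
  have -> : size P1 + (rsize a + 1).+1 = size P1 + rsize a + 2 by lia.
  set cb := code _ b; set pc := _ + 2.
  have -> : (P1 ++ J :: code (size P1).+1 a ++ [:: L]) ++ cb ++ P2 =
            P1 ++ (J :: code (size P1).+1 a ++ L :: cb) ++ P2.
    by rewrite -!catA /= -!catA.
  move=> IH; rewrite addSn (@exec_jz _ _ _ _ r _ (nth_pivot _ _ _ _)) z eqxx -/pc IH.
  by congr (exec _ _ _ _); rewrite /pc; lia.
- move=> r a m z wa P1 P2 f; cbn [code rsize]; set pc := _ + 2.
  by rewrite add1n (@exec_jz _ _ _ _ r _ (nth_pivot _ _ _ _)) z eqxx /pc addnA.
- move=> r a m t m' t' m'' nz _ IHa _ IHw wa P1 P2 f.
  have {IHw} := IHw wa P1 P2 f; cbn [code rsize]; set pc := _ + 2; set J := IJz _ _.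
  set P := P1 ++ _ => IHw.
  have E1 : P = rcons P1 J ++ code (size (rcons P1 J)) a ++ IJmp (size P1) :: P2.
    by rewrite size_rcons cat_rcons /P /= -catA.
  have E2 : P = (rcons P1 J ++ code (size (rcons P1 J)) a) ++ IJmp (size P1) :: P2.
    by rewrite E1 -catA.
  rewrite addSn (@exec_jz _ _ _ _ r _ (nth_pivot _ _ _ _)) (negPf nz) addSnnS -addnA.
  have := IHa wa (rcons P1 J) (IJmp (size P1) :: P2) (t' + f.+1); rewrite -E1 size_rcons => ->.
  rewrite addnS (@exec_jmp _ _ _ _ (size P1)) ?IHw //.
  by rewrite E2 nth_pivot_at // size_cat size_code size_rcons.
Qed.

(** The strict [t < f] pays for the implicit halt when the program counter runs past the end. *)
Lemma exec_rcmd c m t m' f : rwf c -> reval c m t m' -> t < f ->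
  exec (code 0 c) f 0 m = Some m'.
Proof.
move=> wc ev lt; have := exec_code ev wc [::] [::] (f - t); rewrite cats0 /= subnKC 1?ltnW // => ->.
case E: (f - t) => [|k] /=; first by lia.
by rewrite nth_default // size_code.
Qed.

(** * A language with variables and arrays, and its compilation *)

Inductive expr :=
  | ECst of nat
  | EVar of nat
  | EAdd of expr & expr
  | ESub of expr & expr
  | EGet of nat & expr.

Inductive cmd :=
  | Skip
  | Set_ of nat & expr
  | Put of nat & expr & expr
  | Seq of cmd & cmd
  | If of expr & cmd & cmd
  | Loop of expr & cmd.

Record state := State { rg : nat -> nat; ar : nat -> nat -> nat }.

Definition setr (s : state) r x := State (upd (rg s) r x) (ar s).
Definition seta (s : state) a i x :=
  State (rg s) (fun b => if b == a then upd (ar s b) i x else ar s b).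

Fixpoint eval (s : state) (e : expr) : nat :=
  match e with
  | ECst k => k
  | EVar r => rg s r
  | EAdd a b => eval s a + eval s b
  | ESub a b => eval s a - eval s b
  | EGet a i => ar s a (eval s i)
  end.

Inductive ceval : cmd -> state -> nat -> state -> Prop :=
  | CevSkip s : ceval Skip s 0 s
  | CevSet r e s : ceval (Set_ r e) s 1 (setr s r (eval s e))
  | CevPut a i e s : ceval (Put a i e) s 1 (seta s a (eval s i) (eval s e))
  | CevSeq c c' s t s' t' s'' :
      ceval c s t s' -> ceval c' s' t' s'' -> ceval (Seq c c') s (t + t') s''
  | CevIfN e c c' s t s' : eval s e != 0 -> ceval c s t s' -> ceval (If e c c') s t.+1 s'
  | CevIfZ e c c' s t s' : eval s e = 0 -> ceval c' s t s' -> ceval (If e c c') s t.+1 s'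
  | CevLoopZ e c s : eval s e = 0 -> ceval (Loop e c) s 1 s
  | CevLoopN e c s t s' t' s'' : eval s e != 0 -> ceval c s t s' ->
      ceval (Loop e c) s' t' s'' -> ceval (Loop e c) s (t + t').+1 s''.

(** Cells 0 to 23 hold the variables, cell 24 the base address of the arrays, and cells 25 to 39 the
    stack of intermediate values. The arrays start at or above [nreg]. *)
Local Notation nvar := 24 (only parsing).
Local Notation rbase := 24 (only parsing).
Local Notation tmp0 := 25 (only parsing).
Local Notation nreg := 40 (only parsing).

(** [t] is the top of the stack: the value is left in cell [t], and nothing below it changes. Moving
    is done by adding to 0, and four doublings multiply an index by the stride 16. *)
Fixpoint cexpr (e : expr) (t : nat) : seq instr :=
  match e with
  | ECst k => [:: IConst t k]
  | EVar r => [:: IConst t 0; IAdd t t r]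
  | EAdd a b => cexpr a t ++ cexpr b t.+1 ++ [:: IAdd t t t.+1]
  | ESub a b => cexpr a t ++ cexpr b t.+1 ++ [:: ISub t t t.+1]
  | EGet a i => cexpr i t ++ nseq 4 (IAdd t t t) ++
      [:: IAdd t t rbase; IConst t.+1 a; IAdd t t t.+1; ILoad t t]
  end.

Fixpoint wfexpr (e : expr) (t : nat) : bool :=
  match e with
  | ECst k => t < nreg
  | EVar r => (r < nvar) && (t < nreg)
  | EAdd a b | ESub a b => wfexpr a t && wfexpr b t.+1
  | EGet a i => [&& a < 16, wfexpr i t & t.+1 < nreg]
  end.

Fixpoint ccmd (c : cmd) : rcmd :=
  match c with
  | Skip => RPrims [::]
  | Set_ r e => RPrims (cexpr e tmp0 ++ [:: IConst r 0; IAdd r r tmp0])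
  | Put a i e => RPrims (cexpr i tmp0 ++ nseq 4 (IAdd tmp0 tmp0 tmp0) ++
      [:: IAdd tmp0 tmp0 rbase; IConst tmp0.+1 a; IAdd tmp0 tmp0 tmp0.+1] ++
      cexpr e tmp0.+1 ++ [:: IStore tmp0 tmp0.+1])
  | Seq a b => RSeq (ccmd a) (ccmd b)
  | If e a b => RSeq (RPrims (cexpr e tmp0)) (RIf tmp0 (ccmd a) (ccmd b))
  | Loop e a => RSeq (RPrims (cexpr e tmp0))
      (RWhile tmp0 (RSeq (ccmd a) (RPrims (cexpr e tmp0))))
  end.

Fixpoint wfcmd (c : cmd) : bool :=
  match c with
  | Skip => true
  | Set_ r e => (r < nvar) && wfexpr e tmp0
  | Put a i e => [&& a < 16, wfexpr i tmp0 & wfexpr e tmp0.+1]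
  | Seq a b => wfcmd a && wfcmd b
  | If e a b => [&& wfexpr e tmp0, wfcmd a & wfcmd b]
  | Loop e a => wfexpr e tmp0 && wfcmd a
  end.

(* Number of machine steps charged per unit of [ceval] time. *)
Fixpoint weight (c : cmd) : nat :=
  match c with
  | Skip => 0
  | Set_ _ _ | Put _ _ _ => rsize (ccmd c)
  | Seq a b => weight a + weight b
  | If e a b => size (cexpr e tmp0) + 2 + weight a + weight b
  | Loop e a => size (cexpr e tmp0) + 2 + weight a
  end.

(* Cell [i] of array [a] lives at address [B + 16 * i + a], so that the sixteen
   arrays are unbounded and never overlap. *)
Definition rep (B : nat) (s : state) (m : memory) : Prop :=
  [/\ nreg <= B, m rbase = B, forall r, r < nvar -> m r = rg s r &
      forall a i, a < 16 -> m (B + 16 * i + a) = ar s a i].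

Lemma rep_ext B s m m' : rep B s m ->
  (forall x, x < tmp0 \/ nreg <= x -> m' x = m x) -> rep B s m'.
Proof.
move=> [le mB mr ma] E; split=> // [|r lr|a i la].
- by rewrite E //; left.
- by rewrite E ?mr //; lia.
- by rewrite E ?ma //; lia.
Qed.

Lemma all_prim_cexpr e t : all prim (cexpr e t).
Proof. by elim: e t => //= [a IHa b IHb|a IHa b IHb|a i IHi] t; rewrite !all_cat ?IHa ?IHb ?IHi. Qed.

Lemma rwf_ccmd c : rwf (ccmd c).
Proof.
elim: c => //= [r e|a i e|a -> b ->|e a -> b ->|e a ->] //=; rewrite ?all_cat ?all_prim_cexpr //=.
by rewrite !all_cat ?all_prim_cexpr.
Qed.

Lemma psteps_cat m l l' : psteps m (l ++ l') = psteps (psteps m l) l'.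
Proof. exact: foldl_cat. Qed.

Lemma wfexpr_lt e t : wfexpr e t -> t < nreg.
Proof.
elim: e t => //= [r|a IHa b IHb|a IHa b IHb|a i IHi] t; first by case/andP.
- by case/andP=> /IHa.
- by case/andP=> /IHa.
- by case/and3P=> _ /IHi.
Qed.

Lemma cexprP B s m e t : rep B s m -> tmp0 <= t -> wfexpr e t ->
  psteps m (cexpr e t) t = eval s e /\
  forall x, x < t \/ nreg <= x -> psteps m (cexpr e t) x = m x.
Proof.
elim: e m t => [k|r|a IHa b IHb|a IHa b IHb|a i IHi] m t rp lt /=.
- by move=> lr; rewrite /upd eqxx; split=> // x hx; case: eqP => // xt; lia.
- case/andP=> lr ltn; rewrite /upd eqxx; split.
    have -> : (r == t) = false by lia.
    by case: rp => _ _ -> //.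
  by move=> x hx; case: eqP => // xt; lia.
- case/andP=> wa wb; have [Ea Fa] := IHa m t rp lt wa.
  have rp1 : rep B s (psteps m (cexpr a t)).
    by apply: (rep_ext rp) => x hx; apply: Fa; lia.
  have [Eb Fb] := IHb _ t.+1 rp1 (leqW lt) wb.
  rewrite !psteps_cat /= /upd eqxx Fb ?Ea ?Eb; last by left.
  split=> // x hx; case: eqP => [xt|_]; last by rewrite Fb ?Fa //; lia.
  by case: hx => [|hx]; [lia|move: (wfexpr_lt wb); lia].
- case/andP=> wa wb; have [Ea Fa] := IHa m t rp lt wa.
  have rp1 : rep B s (psteps m (cexpr a t)).
    by apply: (rep_ext rp) => x hx; apply: Fa; lia.
  have [Eb Fb] := IHb _ t.+1 rp1 (leqW lt) wb.
  rewrite !psteps_cat /= /upd eqxx Fb ?Ea ?Eb; last by left.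
  split=> // x hx; case: eqP => [xt|_]; last by rewrite Fb ?Fa //; lia.
  by case: hx => [|hx]; [lia|move: (wfexpr_lt wb); lia].
- case/and3P=> la wi lt1; have [Ei Fi] := IHi m t rp lt wi.
  rewrite psteps_cat; set m1 := psteps m _ in Ei Fi *.
  have mB : m1 rbase = B by rewrite Fi; [case: rp|lia].
  have Eb : (rbase == t) = false by lia.
  have Et : (t == t.+1) = false by lia.
  have Et' : (t.+1 == t) = false by lia.
  have neB : (B + 16 * eval s i + a == t) = false by case: rp; lia.
  have neB' : (B + 16 * eval s i + a == t.+1) = false by case: rp; lia.
  rewrite /= /upd !eqxx ?Eb ?Et ?Et' ?eqxx Ei mB.
  have -> : eval s i + eval s i + (eval s i + eval s i) +
    (eval s i + eval s i + (eval s i + eval s i)) +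
    (eval s i + eval s i + (eval s i + eval s i) +
    (eval s i + eval s i + (eval s i + eval s i))) + B + a = B + 16 * eval s i + a by lia.
  rewrite neB neB'; split.
    rewrite Fi; first by case: rp => _ _ _ ->.
    by case: rp; lia.
  by move=> x hx; do ![case: eqP => [?|_]; first by lia]; apply: Fi; lia.
Qed.

Lemma rep_setr B s m m' r v : rep B s m -> r < nvar -> m' r = v ->
  (forall x, x != r -> x < tmp0 \/ nreg <= x -> m' x = m x) -> rep B (setr s r v) m'.
Proof.
move=> [le mB mr ma] lr Er E; split=> // [|r' lr'|a i la].
- by rewrite E //; [apply/eqP; lia|left].
- rewrite /= /upd; case: eqP => [-> //|/eqP ne].
  by rewrite E ?mr //; lia.
- by rewrite E ?ma //; lia.
Qed.

Lemma rep_seta B s m m' a i v : rep B s m -> a < 16 -> m' (B + 16 * i + a) = v ->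
  (forall x, x != B + 16 * i + a -> x < tmp0 \/ nreg <= x -> m' x = m x) ->
  rep B (seta s a i v) m'.
Proof.
move=> [le mB mr ma] la Ea E; split=> // [|r lr|b j lb].
- by rewrite E //; [apply/eqP; lia|left].
- by rewrite E ?mr //; lia.
- rewrite /= /upd; case: eqP => [->|/eqP ne]; last by rewrite E ?ma //; lia.
  by case: eqP => [-> //|/eqP ne]; rewrite E ?ma //; lia.
Qed.

(** [W] is fixed for the whole derivation, so that sub-commands and the remaining iterations of a
    loop are charged at the same rate as the command itself. *)
Lemma ccmd_correct W B c s t s' : ceval c s t s' -> forall m, wfcmd c -> weight c <= W ->
  rep B s m -> exists m' t', [/\ reval (ccmd c) m t' m', t' <= W * t & rep B s' m'].
Proof.
elim=> {c s t s'} /=.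
- by move=> s m _ _ rp; exists m, 0; split=> //; exact: (RevPrims [::]).
- move=> r e s m /andP[lr we] leW rp; have [Ee Fe] := cexprP rp (leqnn tmp0) we.
  eexists; eexists; split; [exact: RevPrims|by rewrite muln1|].
  rewrite psteps_cat; apply: (rep_setr rp) => //=.
    by rewrite /upd eqxx; have -> : (tmp0 == r) = false by lia; rewrite Ee.
  by move=> x ne hx; rewrite /upd (negPf ne) Fe.
- move=> a i e s m /and3P[la wi we] leW rp; have [Ei Fi] := cexprP rp (leqnn tmp0) wi.
  eexists; eexists; split; [exact: RevPrims|by rewrite muln1|].
  rewrite psteps_cat; set m1 := psteps m (cexpr i tmp0) in Ei Fi *.
  pose l := nseq 4 (IAdd tmp0 tmp0 tmp0) ++
    [:: IAdd tmp0 tmp0 rbase; IConst tmp0.+1 a; IAdd tmp0 tmp0 tmp0.+1].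
  rewrite -[psteps m1 _]/(psteps m1 (l ++ cexpr e tmp0.+1 ++ [:: IStore tmp0 tmp0.+1])).
  rewrite !psteps_cat; set m2 := psteps m1 l.
  have mB : m1 rbase = B by rewrite Fi; [case: rp|left].
  have E2 : m2 tmp0 = B + 16 * eval s i + a /\ forall x, x < tmp0 \/ nreg <= x -> m2 x = m1 x.
    rewrite /m2 /l /= /upd /= Ei mB; split; first by lia.
    by move=> x hx; do ![case: eqP => [?|_]; first by lia].
  case: E2 => E2 F2.
  have rp2 : rep B s m2 by apply: (rep_ext rp) => x hx; rewrite F2 ?Fi.
  have [Ee Fe] := cexprP rp2 (leqnSn tmp0) we.
  apply: (rep_seta rp) => //=; rewrite /upd Fe ?E2 ?eqxx ?Ee //; try by left.
  move=> x ne hx; rewrite (negPf ne) Fe ?F2 ?Fi //; lia.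
- move=> c c' s t s' t' s'' _ IH _ IH' m /andP[wc wc'] leW rp.
  have [|m1 [t1 [ev1 le1 rp1]]] := IH m wc _ rp; first by lia.
  have [|m2 [t2 [ev2 le2 rp2]]] := IH' m1 wc' _ rp1; first by lia.
  exists m2, (t1 + t2); split=> //; first exact: RevSeq ev1 ev2.
  by rewrite mulnDr leq_add.
- move=> e c c' s t s' nz _ IH m /and3P[we wc wc'] leW rp.
  have [Ee Fe] := cexprP rp (leqnn tmp0) we.
  have rp0 := rep_ext rp Fe.
  have [|m1 [t1 [ev1 le1 rp1]]] := IH _ wc _ rp0; first by lia.
  eexists; eexists; split; last exact: rp1.
    by apply: RevSeq (RevPrims _ _) _; apply: RevIfN ev1; rewrite Ee.
  by rewrite mulnS; lia.
- move=> e c c' s t s' z _ IH m /and3P[we wc wc'] leW rp.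
  have [Ee Fe] := cexprP rp (leqnn tmp0) we.
  have rp0 := rep_ext rp Fe.
  have [|m1 [t1 [ev1 le1 rp1]]] := IH _ wc' _ rp0; first by lia.
  eexists; eexists; split; last exact: rp1.
    by apply: RevSeq (RevPrims _ _) _; apply: RevIfZ ev1; rewrite Ee.
  by rewrite mulnS; lia.
- move=> e c s z m /andP[we wc] leW rp.
  have [Ee Fe] := cexprP rp (leqnn tmp0) we.
  eexists; eexists; split; last exact: rep_ext rp Fe.
    by apply: RevSeq (RevPrims _ _) (RevWhileZ _ _); rewrite Ee.
  by rewrite muln1; lia.
- move=> e c s t s' t' s'' nz _ IH _ IH' m /andP[we wc] leW rp.
  have [Ee Fe] := cexprP rp (leqnn tmp0) we.
  have rp0 := rep_ext rp Fe.
  have [|m1 [t1 [ev1 le1 rp1]]] := IH _ wc _ rp0; first by lia.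
  have [||m2 [t2 [ev2 le2 rp2]]] := IH' m1 _ _ rp1; [by rewrite we|by []|].
  (* The remaining iterations are compiled as a test followed by [RWhile]; splitting them moves this
     test to the end of the current body. *)
  inversion ev2 as [|? ? ? t3 m3 t4 ? ev3 ev4| | | |]; subst.
  eexists; eexists; split; last exact: rp2.
    apply: RevSeq (RevPrims _ _) _; apply: RevWhileN ev4; first by rewrite Ee.
    exact: RevSeq ev1 ev3.
  by rewrite mulnS mulnDr; lia.
Qed.

(** * Total correctness with a time bound *)

Definition wp (c : cmd) (t : nat) (Q : state -> Prop) (s : state) : Prop :=
  exists s' t', [/\ ceval c s t' s', t' <= t & Q s'].

Lemma wp_conseq c t t' (Q Q' : state -> Prop) s : wp c t Q s -> t <= t' ->
  (forall s', Q s' -> Q' s') -> wp c t' Q' s.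
Proof.
by move=> [s' [k [ev le q]]] let' QQ'; exists s', k; split; [|exact: leq_trans le _|exact: QQ'].
Qed.

Lemma wp_skip t (Q : state -> Prop) s : Q s -> wp Skip t Q s.
Proof. by move=> q; exists s, 0; split; [exact: CevSkip| |]. Qed.

Lemma wp_set r e (Q : state -> Prop) s : Q (setr s r (eval s e)) -> wp (Set_ r e) 1 Q s.
Proof. by move=> q; eexists; exists 1; split; [exact: CevSet| |]. Qed.

Lemma wp_put a i e (Q : state -> Prop) s :
  Q (seta s a (eval s i) (eval s e)) -> wp (Put a i e) 1 Q s.
Proof. by move=> q; eexists; exists 1; split; [exact: CevPut| |]. Qed.

Lemma wp_seq c c' t t' Q s : wp c t (wp c' t' Q) s -> wp (Seq c c') (t + t') Q s.
Proof.
move=> [s1 [t1 [ev1 le1 [s2 [t2 [ev2 le2 q]]]]]].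
by exists s2, (t1 + t2); split=> //; [exact: CevSeq ev1 ev2|exact: leq_add].
Qed.

Lemma wp_if e c c' t Q s : (eval s e != 0 -> wp c t Q s) -> (eval s e = 0 -> wp c' t Q s) ->
  wp (If e c c') t.+1 Q s.
Proof.
move=> HN HZ; have [z|nz] := boolP (eval s e == 0).
  have [s' [k [ev le q]]] := HZ (eqP z); exists s', k.+1; split=> //.
  exact: CevIfZ (eqP z) ev.
have [s' [k [ev le q]]] := HN nz; exists s', k.+1; split=> //.
exact: CevIfN nz ev.
Qed.

(** [f i] bounds iteration [i], and each test adds 1. The start [k] is free because the parsing loop
    begins at vertex 1. *)
Lemma wp_loop (Inv : nat -> state -> Prop) (f : nat -> nat) k N e c s :
  (forall i s, i < N -> Inv i s -> eval s e != 0 /\ wp c (f i) (Inv i.+1) s) ->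
  (forall s, Inv N s -> eval s e = 0) -> k <= N -> Inv k s ->
  wp (Loop e c) (\sum_(k <= i < N) (f i).+1).+1 (Inv N) s.
Proof.
move=> step stop; have [m] := ubnP (N - k); elim: m k s => // m IH k s /ltnSE le.
rewrite leq_eqVlt => /predU1P[->|lt] inv.
  by rewrite big_geq //; exists s, 1; split=> //; apply: CevLoopZ; exact: stop.
have [nz [s1 [t1 [ev1 le1 inv1]]]] := step k s lt inv.
have [|s2 [t2 [ev2 le2 inv2]]] := IH k.+1 s1 _ lt inv1; first by lia.
exists s2, (t1 + t2).+1; split=> //; first exact: CevLoopN ev1 ev2.
by rewrite big_ltn // addSn; lia.
Qed.

Lemma wp_loop_const (Inv : nat -> state -> Prop) f N e c s :
  (forall i s, i < N -> Inv i s -> eval s e != 0 /\ wp c f (Inv i.+1) s) ->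
  (forall s, Inv N s -> eval s e = 0) -> Inv 0 s ->
  wp (Loop e c) (N * f.+1).+1 (Inv N) s.
Proof.
move=> step stop inv; have := wp_loop (f := fun=> f) step stop (leq0n N) inv.
by rewrite sum_nat_const_nat subn0.
Qed.

Fixpoint writes_reg (c : cmd) (r : nat) : bool :=
  match c with
  | Set_ r' _ => r == r'
  | Seq a b | If _ a b => writes_reg a r || writes_reg b r
  | Loop _ a => writes_reg a r
  | _ => false
  end.

Fixpoint writes_arr (c : cmd) (a : nat) : bool :=
  match c with
  | Put b _ _ => a == b
  | Seq c c' | If _ c c' => writes_arr c a || writes_arr c' a
  | Loop _ c => writes_arr c a
  | _ => false
  end.

Definition frame (c : cmd) (s s' : state) : Prop :=
  (forall r, ~~ writes_reg c r -> rg s' r = rg s r) /\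
  (forall a, ~~ writes_arr c a -> ar s' a = ar s a).

Lemma ceval_frame c s t s' : ceval c s t s' -> frame c s s'.
Proof.
elim=> {c s t s'} //=.
- by move=> r e s; split=> //= r' ne; rewrite /upd (negPf ne).
- by move=> a i e s; split=> //= b ne; rewrite (negPf ne).
- move=> c c' s t s' t' s'' _ [IHr IHa] _ [IHr' IHa'].
  split=> x /=; rewrite negb_or => /andP[nx nx']; first by rewrite IHr' ?IHr.
  by rewrite IHa' ?IHa.
- move=> e c c' s t s' _ _ [IHr IHa].
  by split=> x /=; rewrite negb_or => /andP[nx nx']; rewrite ?IHr ?IHa.
- move=> e c c' s t s' _ _ [IHr IHa].
  by split=> x /=; rewrite negb_or => /andP[nx nx']; rewrite ?IHr ?IHa.
- move=> e c s t s' t' s'' _ _ [IHr IHa] _ [IHr' IHa'].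
  by split=> x /= nx; rewrite ?IHr' ?IHr ?IHa' ?IHa.
Qed.

Lemma wp_frame c t Q s : wp c t Q s -> wp c t (fun s' => Q s' /\ frame c s s') s.
Proof.
by move=> [s' [k [ev le q]]]; exists s', k; split=> //; split=> //; exact: ceval_frame ev.
Qed.

(** * Relocating the input and writing the output *)

Section Encoding.
Variables (n : nat) (e : rel 'I_n).

Definition blocks : seq (seq nat) :=
  [seq size (nbrs e v) :: nbrs e v | v <- enum 'I_n].

Definition offset (k : nat) : nat := (size (flatten (take k blocks))).+1.

Definition input (i : nat) : nat := nth 0 (enc_graph e) i.

Lemma size_nbrs v : size (nbrs e v) = degree e v.
Proof.
rewrite /nbrs size_map size_filter /degree cardsE cardE /enum_mem size_filter.
by rewrite (eq_filter (a2 := predT)) // filter_predT.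
Qed.

Lemma size_blocks : size blocks = n.
Proof. by rewrite size_map size_enum_ord. Qed.

Lemma nth_blocks (v : 'I_n) : nth [::] blocks v = size (nbrs e v) :: nbrs e v.
Proof. by rewrite (nth_map v) ?size_enum_ord // nth_ord_enum. Qed.

Lemma offset0 : offset 0 = 1. Proof. by rewrite /offset take0. Qed.

Lemma offsetS (v : 'I_n) : offset v.+1 = offset v + degree e v + 1.
Proof.
rewrite /offset (take_nth [::]) ?size_blocks // nth_blocks -cats1 flatten_cat.
by rewrite size_cat /= cats0 size_nbrs; lia.
Qed.

Lemma offset_n : offset n = size (enc_graph e).
Proof. by rewrite /offset take_oversize // size_blocks. Qed.

Lemma input_offset (v : 'I_n) j :
  j <= degree e v -> input (offset v + j) = nth 0 (degree e v :: nbrs e v) j.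
Proof.
move=> lj; rewrite /input /enc_graph -/blocks addSn /= -{1}(cat_take_drop v blocks).
rewrite flatten_cat nth_cat ltnNge leq_addr /= addKn.
rewrite (drop_nth [::]) ?size_blocks // nth_blocks -size_nbrs.
by rewrite -cat1s flatten_cat nth_cat /= cats0 ltnS size_nbrs lj.
Qed.

Lemma input_end i : offset n <= i -> input i = 0.
Proof. by rewrite offset_n => le; rewrite /input nth_default. Qed.

Lemma input_degree (v : 'I_n) : input (offset v) = degree e v.
Proof. by rewrite -{1}[offset v]addn0 input_offset. Qed.

Lemma offset_mono k l : k <= l -> offset k <= offset l.
Proof.
move=> le; rewrite /offset ltnS -(cat_take_drop k (take l blocks)) take_takel //.
by rewrite flatten_cat size_cat leq_addr.
Qed.

Lemma offset_gt k : k <= n -> k < offset k.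
Proof.
elim: k => [|k IH] lt; first by rewrite offset0.
by have := offsetS (Ordinal lt); have := IH (ltnW lt); rewrite /=; lia.
Qed.

Lemma offset_le D k : (forall v, degree e v <= D) -> k <= n -> offset k <= k * D.+1 + 1.
Proof.
move=> deg; elim: k => [|k IH] lt; first by rewrite offset0.
have := offsetS (Ordinal lt); have := deg (Ordinal lt); have := IH (ltnW lt).
by rewrite /= mulSn; lia.
Qed.

Hypotheses (n_gt0 : 0 < n) (e_irr : irreflexive e) (e_conn : gconnected e).

Lemma degree_gt0 (v : 'I_n) : 1 < n -> 0 < degree e v.
Proof.
move=> n1; have [w nw] : exists w : 'I_n, w != v.
  have [->|ne] := eqVneq v (Ordinal n_gt0); first by exists (Ordinal n1).
  by exists (Ordinal n_gt0); rewrite eq_sym.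
have := e_conn v w; case/connectP=> [[|x p] /=]; first by move=> _ E; rewrite E eqxx in nw.
by case/andP=> vx _ _; apply/card_gt0P; exists x; rewrite inE.
Qed.

Lemma offset1 : offset 1 = input 1 + 2.
Proof.
have := offsetS (Ordinal n_gt0); have := input_degree (Ordinal n_gt0).
by rewrite /= offset0 => -> ->; lia.
Qed.

(** Cell 0 steps from block to block and cell 2 holds the degree found there. A degree 0 is met only
    past the end: memory is 0 there, and for [n > 1] connectedness makes all degrees positive. The
    increment by 1 reuses cell 2, whose degree has already been added. *)
Definition scan_body : seq instr :=
  [:: IAdd 0 0 2; IConst 2 1; IAdd 0 0 2; ILoad 2 0].

Definition scan : rcmd :=
  RSeq (RPrims [:: IConst 0 2; IAdd 0 0 1; ILoad 2 0]) (RWhile 2 (RPrims scan_body)).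

Lemma scan_loop k m : 1 < n -> 0 < k <= n -> m 0 = offset k -> m 2 = input (offset k) ->
  (forall x : nat, x != 0 -> x != 2 -> m x = input x) ->
  exists m' t, [/\ reval (RWhile 2 (RPrims scan_body)) m t m', t <= 6 * (n - k) + 1,
    m' 0 = offset n & forall x : nat, x != 0 -> x != 2 -> m' x = input x].
Proof.
move=> n1; have [j] := ubnP (n - k); elim: j k m => // j IH k m /ltnSE le /andP[k0 kn].
move: kn; rewrite leq_eqVlt => /predU1P[kE|kn] m0 m2 mx.
  exists m, 1; split; rewrite ?m0 ?kE //; last by lia.
  by apply: RevWhileZ; rewrite m2 kE input_end.
set v : 'I_n := Ordinal kn.
have dv : input (offset k) = degree e v := input_degree v.
have oS : offset k.+1 = offset k + degree e v + 1 := offsetS v.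
have off1 : offset 1 <= offset k.+1 by apply: offset_mono.
have := offsetS (Ordinal n_gt0); rewrite /= offset0 => o1.
have d0 := degree_gt0 (Ordinal n_gt0) n1.
have [|||||m' [t [ev let' m'0 m'x]]] := IH k.+1 (psteps m scan_body).
- lia.
- lia.
- by rewrite /= /upd /= m0 m2 dv oS.
(* The address read next is past both scratch cells, so the input there is intact. *)
- have ne2 : (offset k.+1 == 2) = false by lia.
  have ne0 : (offset k.+1 == 0) = false by lia.
  by rewrite /= /upd /= m0 m2 dv -oS ne2 ne0 mx ?ne2 ?ne0.
- by move=> x x0 x2; rewrite /= /upd /= (negPf x0) (negPf x2) mx.
exists m', (4 + t).+2; split=> //; last by lia.
apply: RevWhileN ev; last exact: RevPrims.
by rewrite m2 dv -lt0n degree_gt0.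
Qed.

Lemma scanP : exists m t, [/\ reval scan (init_mem (enc_graph e)) t m,
  t <= 6 * n + 4, m 0 = offset n & forall x : nat, x != 0 -> x != 2 -> m x = input x].
Proof.
set m0 := init_mem _; set l := [:: IConst 0 2; IAdd 0 0 1; ILoad 2 0].
have E0 : psteps m0 l 0 = offset 1.
  by rewrite /= /upd /= offset1 addnC.
have E2 : psteps m0 l 2 = if offset 1 == 2 then m0 2 else m0 (offset 1).
  rewrite /= /upd /= offset1 addnC -[m0 1]/(input 1).
  by case: eqP => // ->.
have Ex x : x != 0 -> x != 2 -> psteps m0 l x = input x.
  by move=> x0 x2; rewrite /= /upd /= (negPf x0) (negPf x2).
have E2' : psteps m0 l 2 = input (offset 1) by rewrite E2; case: eqP => [->|].
have [n1|n1] := leqP n 1.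
  have nE : n = 1 by lia.
  exists (psteps m0 l), (3 + 1); split=> //; last by rewrite E0 (congr1 offset nE).
    apply: RevSeq (RevPrims _ _) (RevWhileZ _ _).
    by rewrite E2' -(congr1 offset nE) input_end.
  by lia.
have [|m [t [ev let' m'0 m'x]]] := @scan_loop 1 (psteps m0 l) n1 _ E0 E2' Ex; first by lia.
exists m, (3 + t); split=> //; first exact: RevSeq (RevPrims _ _) ev.
by lia.
Qed.

End Encoding.

(** The cells below [nreg] are stored one by one with literal addresses, since a loop would need
    registers that still hold input. Only afterwards are cells 3 to 7 and [rbase] overwritten for
    the copying loop. Adding 16 twice after cell 1 skips the index of the lost cell 2. *)
Definition save_prims : seq instr :=
  [:: IConst 2 nreg; IAdd 0 0 2; IConst 2 16; IAdd 0 0 2; IStore 0 1; IAdd 0 0 2] ++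
  flatten [seq [:: IAdd 0 0 2; IStore 0 i] | i <- iota 3 (nreg - 3)] ++
  [:: IConst 3 (16 * nreg.-1); ISub rbase 0 3; IConst 3 nreg; ISub 4 rbase 3;
      IConst 5 nreg; IConst 6 1; ISub 7 4 5].

Definition copy_prims : seq instr :=
  [:: IAdd 0 0 2; ILoad 8 5; IStore 0 8; IAdd 5 5 6; ISub 7 4 5].

Definition relocate : rcmd := RSeq (RPrims save_prims) (RWhile 7 (RPrims copy_prims)).

Lemma RevPrims3 l1 l2 l3 m m1 m2 m3 :
  m1 = psteps m l1 -> m2 = psteps m1 l2 -> m3 = psteps m2 l3 ->
  reval (RPrims (l1 ++ l2 ++ l3)) m (size (l1 ++ l2 ++ l3)) m3.
Proof. by move=> -> -> ->; rewrite -!psteps_cat; exact: RevPrims. Qed.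

Section Relocation.
Variables (inp : nat -> nat) (L : nat).
Hypothesis inp_end : forall i, L <= i -> inp i = 0.
Local Notation B := (L + nreg).

(** The copy has reached index [j], and the input from [nreg] on is untouched. All other array cells
    are 0 because memory past the input is; this provides the initial zeros of the label and table
    arrays. *)
Definition relocated (j : nat) (m : memory) : Prop :=
  (forall x, nreg <= x < B -> m x = inp x) /\
  (forall i a, a < 16 ->
     m (B + 16 * i + a) = if [&& a == 0, i != 0, i != 2 & i < j] then inp i else 0).

Lemma save_loop k m : 3 + k <= nreg ->
  m 0 = B + 32 -> m 2 = 16 -> (forall x : nat, x != 0 -> x != 2 -> x < nreg -> m x = inp x) ->
  relocated 3 m ->
  let m' := psteps m (flatten [seq [:: IAdd 0 0 2; IStore 0 i] | i <- iota 3 k]) in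
  [/\ m' 0 = B + 16 * (2 + k), m' 2 = 16,
    forall x : nat, x != 0 -> x != 2 -> x < nreg -> m' x = inp x & relocated (3 + k) m'].
Proof.
elim: k => [|k IH] le m0 m2 mx rel; first by split=> //; lia.
have [m'0 m'2 m'x [rel1 rel2]] := IH (ltnW le) m0 m2 mx rel.
rewrite -[k.+1]addn1 iotaD map_cat flatten_cat /= psteps_cat.
set m' := psteps m _ in m'0 m'2 m'x rel1 rel2 *.
have -> : [:: IAdd 0 0 2; IStore 0 (3 + k)] = [:: IAdd 0 0 2] ++ [:: IStore 0 (3 + k)] by [].
rewrite /= /upd /= m'0 m'2.
set p := B + 16 * (2 + k) + 16; have pE : p = B + 16 * (3 + k) + 0 by rewrite /p; lia.
have m'k : m' (3 + k) = inp (3 + k) by apply: m'x; clear -le; lia.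
rewrite m'k.
split.
- have -> : (0 == p) = false by lia.
  by rewrite pE; lia.
- by have -> : (2 == p) = false by lia.
- move=> x x0 x2 lx; have -> : (x == p) = false by lia.
  by rewrite (negPf x0) m'x.
- split=> [x lx|i a la].
    have -> : (x == p) = false by lia.
    have -> : (x == 0) = false by lia.
    exact: rel1.
  have [E|ne] := eqVneq (B + 16 * i + a) p.
    have -> : a = 0 by lia.
    have -> : i = 3 + k by lia.
    by rewrite /= addn1 addnS ltnSn.
  have -> : (B + 16 * i + a == 0) = false by lia.
  rewrite rel2 //; case: eqP => //= a0.
  by have -> : (i < 3 + (k + 1)) = (i < 3 + k) by lia.
Qed.

Lemma copy_loop i m : nreg <= i -> m 0 + 16 = B + 16 * i -> m 2 = 16 -> m 4 = L ->
  m 5 = i -> m 6 = 1 -> m 7 = L - i -> m rbase = B -> relocated i m ->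
  exists m' t, [/\ reval (RWhile 7 (RPrims copy_prims)) m t m', t <= 7 * (L - i) + 1,
    m' 4 = L /\ m' rbase = B & exists2 j, L <= j & relocated j m'].
Proof.
have [k] := ubnP (L - i); elim: k i m => // k IH i m /ltnSE le li m0 m2 m4 m5 m6 m7 mB [rel1 rel2].
have [leL|ltL] := leqP L i.
  exists m, 1; split=> //; [by apply: RevWhileZ; lia|by lia|by exists i].
set p := B + 16 * i; have pE : p = B + 16 * i + 0 by lia.
have m'E : psteps m copy_prims =1 fun x =>
    if x == 7 then L - i.+1 else if x == 5 then i.+1 else if x == p then inp i
    else if x == 8 then inp i else if x == 0 then p else m x.
  move=> x; rewrite /= /upd /= m5 m2 m6 m4 m0 -/p.
  have -> : (4 == p) = false by lia.
  have -> : (5 == p) = false by lia.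
  have -> : (6 == p) = false by lia.
  have -> : (i == 0) = false by lia.
  by rewrite rel1 ?addn1 //; clear -li ltL; lia.
have [[[p0 p2] p4] [p6 pB]] : ((0 == p) = false) * ((2 == p) = false) * ((4 == p) = false) *
  (((6 == p) = false) * ((rbase == p) = false)) by do !split; lia.
have ev1 := RevPrims copy_prims m.
set m1 := psteps m copy_prims in m'E ev1; clearbody m1.
have [||||||||||m' [t [ev let' m'4 m'rel]]] := IH i.+1 m1;
  rewrite ?m'E /= ?p0 ?p2 ?p4 ?p6 ?pB //; try lia.
- split=> [x lx|j a la]; rewrite m'E.
    do !(case: eqP => ?; first by lia); exact: rel1.
  have [E|ne] := eqVneq (B + 16 * j + a) p.
    rewrite E; have -> : a = 0 by lia.
    have -> : j = i by lia.
    have [-> ->] : (p == 7) = false /\ (p == 5) = false by lia.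
    by rewrite eqxx ltnSn /=; case: ifP => //; lia.
  do !(case: eqP => ?; first by lia).
  rewrite rel2 //; case: eqP => //= a0.
  by have -> : (j < i.+1) = (j < i) by lia.
exists m', (5 + t).+2; split=> //; last by lia.
by apply: RevWhileN ev1 ev; lia.
Qed.

Lemma relocateP m : m 0 = L -> (forall x : nat, x != 0 -> x != 2 -> m x = inp x) ->
  exists m' t, [/\ reval relocate m t m', t <= 7 * L + 90, m' 4 = L /\ m' rbase = B &
    forall i a, a < 16 ->
      m' (B + 16 * i + a) = if [&& a == 0, i != 0 & i != 2] then inp i else 0].
Proof.
move=> m0 mx; rewrite /relocate /save_prims.
set l1 := [:: IConst 2 nreg; _; _; _; _; _]; set l3 := [:: IConst 3 _; _; _; _; _; _; _].
set l2 := flatten _; set m1 := psteps m l1.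
have m1E : m1 =1 fun x => if x == 0 then B + 32 else if x == B + 16 then inp 1 else
    if x == 2 then 16 else m x.
  move=> x; rewrite /m1 /= /upd /= m0 (mx 1) //.
  have -> : (0 == B + 16) = false by lia.
  have -> : (2 == B + 16) = false by lia.
  have -> : B + 16 + 16 = B + 32 by lia.
  by case: (x == 0); case: (x == B + 16); case: (x == 2).
have SL := @save_loop (nreg - 3) m1; cbv zeta in SL.
have {SL}[||||| m20 m22 m2x [rel1 rel2]] := SL.
- by [].
- by rewrite m1E.
- by rewrite m1E /=; have -> : (2 == B + 16) = false by lia.
- move=> x x0 x2 lx; rewrite m1E (negPf x0) (negPf x2) mx //.
  by have -> : (x == B + 16) = false by lia.
- split=> [x lx|i a la]; rewrite m1E.
    do !(case: eqP => ?; first by lia); by apply: mx; lia.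
  have -> : (B + 16 * i + a == 0) = false by lia.
  have -> : (B + 16 * i + a == 2) = false by lia.
  have [E|ne] := eqVneq (B + 16 * i + a) (B + 16).
    have -> : a = 0 by lia.
    by have -> : i = 1 by lia.
  have -> : m (B + 16 * i + a) = 0 by rewrite mx ?inp_end //; lia.
  by have -> : [&& a == 0, i != 0, i != 2 & i < 3] = false by lia.
rewrite -/l2 in m20 m22 m2x rel1 rel2; have [m2 m2E] : exists m2, m2 = psteps m1 l2 by eexists.
rewrite -m2E in m20 m22 m2x rel1 rel2.
set m3 := psteps m2 l3.
have m3E : m3 =1 fun x => if x == 7 then L - nreg else if x == 6 then 1 else
    if x == 5 then nreg else if x == 4 then L else if x == 3 then nreg else
    if x == rbase then B else m2 x.
  have [q qE qB] : exists2 q, m2 0 = q & q - 16 * nreg.-1 = B.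
    by eexists; [exact: m20|lia].
  have BK : B - nreg = L by lia.
  by move=> x; rewrite /m3 /= /upd /= qE qB BK; case: (x == 3).
have [|||||||||m' [t [ev let' [m'4 m'B] [j lj [_ rel]]]]] := @copy_loop nreg m3;
  rewrite ?m3E //= ?m20 ?m22 //; try lia.
  split=> [x lx|i a la]; rewrite m3E.
    by do !(case: eqP => ?; first by lia); exact: rel1.
  by do !(case: eqP => ?; first by lia); exact: rel2.
exists m', (size (l1 ++ l2 ++ l3) + t); split=> //.
- exact: RevSeq (RevPrims3 (erefl m1) m2E (erefl m3)) ev.
- have -> : size (l1 ++ l2 ++ l3) = 87 by [].
  by move: let'; clear; lia.
- move=> i a la; rewrite rel //; case: (ltnP i j) => lij; first by rewrite andbT.
  by rewrite !andbF inp_end ?if_same //; lia.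
Qed.
End Relocation.

Definition prelude : rcmd := RSeq scan relocate.

Lemma preludeP n (e : rel 'I_n) : 0 < n -> gconnected e ->
  exists B s m t, [/\ reval prelude (init_mem (enc_graph e)) t m,
    t <= 13 * offset e n + 94, n <= B, rep B s m &
    [/\ rg s 4 = offset e n, forall i, i != 0 -> i != 2 -> ar s 0 i = input e i,
        ar s 0 2 = 0 & forall a i, 0 < a < 16 -> ar s a i = 0]].
Proof.
move=> n0 conn; have [m1 [t1 [ev1 le1 m10 m1x]]] := scanP n0 conn.
have [m2 [t2 [ev2 le2 [m24 m2B] rel]]] := relocateP (@input_end n e) m10 m1x.
have nle := offset_gt e (leqnn n).
exists (offset e n + nreg), (State m2 (fun a i => m2 (offset e n + nreg + 16 * i + a))).
exists m2, (t1 + t2); split; first exact: RevSeq ev1 ev2.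
- by lia.
- by lia.
- by split=> //; lia.
split=> //= [i i0 i2||a i /andP[a0 la]].
- by rewrite rel // i0 i2.
- by rewrite rel.
- by rewrite rel //; have -> : (a == 0) = false by lia.
Qed.

(** * Writing the output to addresses [0] to [n - 1] *)

Definition emit_prims : seq instr :=
  [:: IConst 1 (16 * nreg + 8); IAdd 1 1 rbase; IConst 2 nreg; IConst 3 1; IConst 4 16; ISub 5 0 2].

Definition emit_body : seq instr :=
  [:: ILoad 6 1; IStore 2 6; IAdd 1 1 4; IAdd 2 2 3; ISub 5 0 2].

(** The registers are output cells too, so they are overwritten from the top down, with cell 0 as
    pointer and cell 1 as stride. At the end these two can only be combined with each other: loading
    puts [E 1] in cell 0 and [E 0] in cell 1, and two subtractions leave [E 0 - E 1] and [E 1]. *)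
Definition emit_low : seq instr :=
  [:: IConst 0 (16 * nreg.-1 + 8); IAdd 0 0 rbase; IConst 1 16] ++
  flatten [seq [:: ILoad (nreg.-1 - j) 0; ISub 0 0 1] | j <- iota 0 (nreg - 2)] ++
  [:: ISub 1 0 1; ILoad 0 0; ILoad 1 1; ISub 0 1 0; ISub 1 1 0].

Definition postlude : rcmd :=
  RSeq (RPrims emit_prims) (RSeq (RWhile 5 (RPrims emit_body)) (RPrims emit_low)).

Section Output.
Variables (B n : nat) (E : nat -> nat).
Hypotheses (le_n_B : n <= B) (le_K_B : nreg <= B).

Definition holds (m : memory) := m rbase = B /\ forall i, m (B + 16 * i + 8) = E i.

Lemma emit_loop i m : holds m -> nreg <= i -> m 0 = n -> m 1 = B + 16 * i + 8 -> m 2 = i ->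
  m 3 = 1 -> m 4 = 16 -> m 5 = n - i -> (forall x, nreg <= x < i -> m x = E x) ->
  exists m' t, [/\ reval (RWhile 5 (RPrims emit_body)) m t m', t <= 7 * (n - i) + 1,
    holds m' & forall x, nreg <= x < n -> m' x = E x].
Proof.
have [k] := ubnP (n - i); elim: k i m => // k IH i m /ltnSE le [mB mE] li m0 m1 m2 m3 m4 m5 mx.
have [leL|ltL] := leqP n i.
  exists m, 1; split=> //; [by apply: RevWhileZ; lia|by lia|].
  by move=> x lx; apply: mx; lia.
have m'E : psteps m emit_body =1 fun x =>
    if x == 5 then n - i.+1 else if x == 2 then i.+1 else if x == 1 then B + 16 * i.+1 + 8
    else if x == i then E i else if x == 6 then E i else m x.
  move=> x; rewrite /= /upd /= m1 m2 m3 m4 mE m0.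
  do 6?[have -> : (0 == i) = false by lia | have -> : (1 == i) = false by lia
    | have -> : (2 == i) = false by lia | have -> : (3 == i) = false by lia
    | have -> : (4 == i) = false by lia].
  have -> : B + 16 * i + 8 + 16 = B + 16 * i.+1 + 8 by lia.
  by rewrite addn1.
have ev1 := RevPrims emit_body m.
set m' := psteps m emit_body in m'E ev1; clearbody m'.
have [||||||||||m'' [t [ev let' m'B m'x]]] := IH i.+1 m'; rewrite ?m'E //=; try lia.
- split=> [|j]; rewrite m'E; do !(case: eqP => ?; first by lia) => //.
- by do !(case: eqP => ?; first by lia).
- by do !(case: eqP => ?; first by lia).
- by do !(case: eqP => ?; first by lia).
- move=> x lx; rewrite m'E; do 3!(case: eqP => ?; first by lia).
  case: eqP => [-> //|ne]; case: eqP => ?; first by lia.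
  by apply: mx; lia.
exists m'', (5 + t).+2; split=> //; last by lia.
by apply: RevWhileN ev1 ev; lia.
Qed.

Lemma emit_low_loop k m : k <= nreg - 2 -> holds m -> m 0 = B + 16 * nreg.-1 + 8 -> m 1 = 16 ->
  (forall x, nreg <= x < n -> m x = E x) ->
  let m' := psteps m (flatten [seq [:: ILoad (nreg.-1 - j) 0; ISub 0 0 1] | j <- iota 0 k]) in
  [/\ m' 0 = B + 16 * (nreg.-1 - k) + 8, m' 1 = 16, forall i, m' (B + 16 * i + 8) = E i &
    forall x, nreg - k <= x < n \/ nreg - k <= x < nreg -> m' x = E x].
Proof.
move=> + [_ mE] m0 m1 mx; elim: k => [|k IH] le.
  by split=> // x [|]; [exact: mx|lia].
have [m'0 m'1 m'E m'x] := IH (ltnW le).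
rewrite -[k.+1]addn1 iotaD map_cat flatten_cat psteps_cat.
set m' := psteps m _ in m'0 m'1 m'E m'x *.
set r := nreg.-1 - k; rewrite add0n.
have mE' : psteps m' (flatten [seq [:: ILoad (nreg.-1 - j) 0; ISub 0 0 1] | j <- iota k 1]) =1
    fun x => if x == 0 then B + 16 * (nreg.-1 - (k + 1)) + 8 else if x == r then E r else m' x.
  move=> x; rewrite /= /upd /= -/r m'0 -/r m'E m'1.
  have -> : (0 == r) = false by rewrite /r; lia.
  have -> : (1 == r) = false by rewrite /r; lia.
  by have -> : B + 16 * r + 8 - 16 = B + 16 * (nreg.-1 - (k + 1)) + 8 by rewrite /r; lia.
split=> [||i|x lx]; rewrite mE' //=.
- by have -> : (1 == r) = false by rewrite /r; lia.
- have -> : (B + 16 * i + 8 == 0) = false by lia.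
  by have -> : (B + 16 * i + 8 == r) = false by rewrite /r; lia.
- have -> : (x == 0) = false by lia.
  by case: eqP => [-> //|ne]; apply: m'x; move: ne; rewrite /r; lia.
Qed.

Lemma postludeP m : holds m -> m 0 = n ->
  exists m' t, [/\ reval postlude m t m', t <= 7 * n + 92,
    E 1 <= E 0 -> m' 0 = E 0 - E 1 /\ m' 1 = E 1 & forall x, 1 < x < n -> m' x = E x].
Proof.
move=> [mB mE] m0.
have m1E : psteps m emit_prims =1 fun x => if x == 5 then n - nreg else if x == 4 then 16 else
    if x == 3 then 1 else if x == 2 then nreg else if x == 1 then 16 * nreg + 8 + B else m x.
  by move=> x; rewrite /= /upd /= mB m0; case: (x == 1).
have ev1 := RevPrims emit_prims m.
set m1 := psteps m emit_prims in m1E ev1; clearbody m1.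
have [|||||||||m2 [t [ev2 le2 [m2B m2E] m2x]]] := @emit_loop nreg m1; rewrite ?m1E //=; try lia.
- by split=> [|i]; rewrite m1E //; do !(case: eqP => ?; first by lia).
pose l1 := [:: IConst 0 (16 * nreg.-1 + 8); IAdd 0 0 rbase; IConst 1 16].
pose l2 := flatten [seq [:: ILoad (nreg.-1 - j) 0; ISub 0 0 1] | j <- iota 0 (nreg - 2)].
pose l3 := [:: ISub 1 0 1; ILoad 0 0; ILoad 1 1; ISub 0 1 0; ISub 1 1 0].
set m3 := psteps m2 l1.
have m3E : m3 =1 fun x => if x == 1 then 16 else if x == 0 then 16 * nreg.-1 + 8 + B else m2 x.
  by move=> x; rewrite /m3 /= /upd /= m2B; case: (x == 1); case: (x == 0).
have EL := @emit_low_loop (nreg - 2) m3; cbv zeta in EL.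
have {EL}[||||| m40 m41 m4E m4x] := EL; rewrite ?m3E //=; try lia.
- by split=> [|i]; rewrite m3E //; do !(case: eqP => ?; first by lia).
- by move=> x lx; rewrite m3E m2x //; do !(case: eqP => ?; first by lia).
rewrite -/l2 in m40 m41 m4E m4x; have [m4 m4D] : exists m4, m4 = psteps m3 l2 by eexists.
rewrite -m4D in m40 m41 m4E m4x.
exists (psteps m4 l3), (6 + (t + size emit_low)); split.
- apply: RevSeq ev1 (RevSeq ev2 _).
  exact: (RevPrims3 (l1 := l1) (erefl m3) m4D (erefl (psteps m4 l3))).
- have -> : size emit_low = 84 by [].
  by lia.
- have e0 := m4E 0; have e1 := m4E 1; rewrite /= /upd /= m40 m41.
  have -> : B + 16 * (39 - 38) + 8 - 16 = B + 16 * 0 + 8 by lia.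
  rewrite [39 - 38]/= -[B + 16 * 1 + 8]/(B + 16 * 1 + 8) e1.
  have -> : (B + 16 * 0 + 8 == 0) = false by lia.
  have -> : (B + 16 * 0 + 8 == 1) = false by lia.
  have -> : (B + 16 * 1 + 8 == 1) = false by lia.
  rewrite e0; lia.
- move=> x lx; rewrite /= /upd /=.
  do 5?[have -> : (x == 0) = false by lia | have -> : (x == 1) = false by lia].
  by rewrite m4x //; lia.
Qed.
End Output.

(** * Breadth-first search *)

Section QueueInvariant.
Variables (n : nat) (e : rel 'I_n) (src : 'I_n).
Hypotheses (e_sym : symmetric e) (e_conn : gconnected e).
Local Notation d := (dist e src).

(** [q] contains all vertices enqueued so far, of which the first [hd] have been expanded. By
    [queue_near] the unexpanded part spans at most two levels, which keeps the queue sorted when a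
    vertex is appended. *)
Record bfs_queue (q : seq 'I_n) (hd : nat) : Prop := BfsQueue {
  queue_uniq : uniq q;
  queue_src : src \in q;
  queue_hd : hd <= size q;
  queue_sorted : forall i j, i <= j < size q -> d (nth src q i) <= d (nth src q j);
  queue_closed : forall i w, i < hd -> e (nth src q i) w -> w \in q;
  queue_near : forall x, hd < size q -> x \in q -> d x <= (d (nth src q hd)).+1
}.

Lemma bfs_queue_init : bfs_queue [:: src] 0.
Proof.
split=> // [||x _]; first exact: mem_head; last by rewrite inE => /eqP->.
by move=> i j /andP[ij]; rewrite ltnS leqn0 => /eqP jE; move: ij; rewrite jE leqn0 => /eqP->.
Qed.

(** By induction on the distance: a predecessor of [x] is in the queue and, being closer than the
    head, has been expanded. For an exhausted queue the premise is void and the whole graph is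
    covered. *)
Lemma bfs_queue_below q hd x : bfs_queue q hd ->
  (hd < size q -> d x <= d (nth src q hd)) -> x \in q.
Proof.
move=> bq; case: (bq) => uq sq hq so cl _.
have [k] := ubnP (d x); elim: k x => // k IH x /ltnSE le near.
case E: (d x) => [|l]; first by rewrite -(dist_eq0 e_conn E).
have [y dy dyx] : exists2 y, d y = l & dist e y x = 1.
  have [|y] := @dist_between _ e e_conn src x l; first by rewrite E.
  by move=> dy; rewrite E subSnn => dyx; exists y.
have yq : y \in q.
  by apply: IH => [|lt]; [rewrite dy -E|have := near lt; rewrite E dy; exact: ltnW].
have [lt|le'] := ltnP (index y q) hd.
  by apply: (cl _ _ lt); rewrite nth_index //; exact: dist1 dyx.
have := so hd (index y q); rewrite le' index_mem yq nth_index // => /(_ isT).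
have := near (leq_ltn_trans le' _); rewrite index_mem yq E => /(_ isT).
by rewrite dy => h1 h2; have := leq_trans h1 h2; rewrite ltnn.
Qed.

Lemma bfs_queue_push q hd w : bfs_queue q hd -> hd < size q ->
  e (nth src q hd) w -> w \notin q ->
  d w = (d (nth src q hd)).+1 /\ bfs_queue (rcons q w) hd.
Proof.
move=> bq lt eu wq; set u := nth src q hd in eu *.
have dw : d w = (d u).+1.
  apply/eqP; rewrite eqn_leq (dist_edgeB e_conn src eu) ltnNge; apply: contra wq => le.
  exact: bfs_queue_below bq _.
case: bq => uq sq hq so cl ne; split=> //; split.
- by rewrite rcons_uniq wq.
- by rewrite mem_rcons inE sq orbT.
- by rewrite size_rcons leqW.
- move=> i j; rewrite size_rcons ltnS => /andP[ij jq].
  rewrite !nth_rcons; move: jq; rewrite leq_eqVlt => /predU1P[jE|jq].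
    rewrite jE ltnn eqxx; case: ltngtP => [iq|iq|_] //; last by lia.
    by rewrite dw; apply: ne lt _; exact: mem_nth.
  by rewrite jq (leq_ltn_trans ij jq) so // ij.
- move=> i x ih; rewrite nth_rcons (leq_trans ih hq) => /(cl _ _ ih).
  by rewrite mem_rcons inE orbC => ->.
- move=> x _; rewrite nth_rcons lt mem_rcons inE -/u => /predU1P[->|xq]; first by rewrite dw.
  exact: ne.
Qed.

Lemma bfs_queue_pop q hd : bfs_queue q hd -> hd < size q ->
  (forall w, e (nth src q hd) w -> w \in q) -> bfs_queue q hd.+1.
Proof.
move=> [uq sq hq so cl ne] lt all; split=> // [i w|x lt' xq].
  by rewrite ltnS leq_eqVlt => /predU1P[->|]; [exact: all|exact: cl].
by apply: leq_trans (ne x lt xq) _; rewrite ltnS so // leqnSn.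
Qed.

Lemma bfs_queue_size q hd : bfs_queue q hd -> size q <= n.
Proof. by case=> uq _ _ _ _ _; rewrite -(card_uniqP uq) -[leqRHS]card_ord max_card. Qed.

Lemma bfs_queue_full q hd : bfs_queue q hd -> size q <= hd -> q =i predT.
Proof. by move=> bq le x; rewrite (bfs_queue_below bq) // ltnNge le. Qed.

Lemma bfs_queue_lt q hd : bfs_queue q hd -> hd < n -> hd < size q.
Proof.
move=> bq lt; rewrite ltnNge; apply/negP => le.
have full := bfs_queue_full bq le; case: (bq) => uq _ hq _ _ _.
have : size q = n by rewrite -(card_uniqP uq) -[RHS]card_ord; apply: eq_card.
by lia.
Qed.

(** Since the queue is sorted, each search also delivers a vertex realizing the eccentricity of its
    source. *)
Lemma bfs_queue_last q : bfs_queue q n -> d (nth src q n.-1) = ecc e src.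
Proof.
move=> bq; have szq : size q = n.
  by apply/eqP; rewrite eqn_leq (bfs_queue_size bq); case: bq.
have full : q =i predT by apply: (bfs_queue_full bq); rewrite szq.
apply/eqP; rewrite eqn_leq ecc_ge /=; apply/bigmax_leqP => x _.
case: bq => _ _ _ so _ _; have xq : x \in q by rewrite full.
rewrite -{1}(nth_index src xq); apply: so.
have lt : index x q < n by move: xq; rewrite -index_mem szq.
have n0 : 0 < n := leq_ltn_trans (leq0n _) lt.
by apply/andP; split; [rewrite -ltnS prednK|rewrite szq ltn_predL].
Qed.

End QueueInvariant.

Local Notation "c1 ;; c2" := (Seq c1 c2) (at level 60, right associativity).

(** * The search program and its correctness *)

Local Notation vN := 0 (only parsing).
Local Notation vL := 4 (only parsing).
Local Notation vI := 1 (only parsing).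
Local Notation vSrc := 2 (only parsing).
Local Notation vHd := 3 (only parsing).
Local Notation vTl := 5 (only parsing).
Local Notation vU := 6 (only parsing).
Local Notation vP := 7 (only parsing).
Local Notation vK := 8 (only parsing).
Local Notation vDu := 9 (only parsing).
Local Notation vW := 10 (only parsing).
Local Notation vT := 11 (only parsing).
Local Notation vH := 12 (only parsing).
Local Notation vC := 13 (only parsing).
Local Notation vX := 14 (only parsing).

Local Notation aIn := 0 (only parsing).
Local Notation aOff := 1 (only parsing).
Local Notation aQ := 2 (only parsing).
Local Notation aD := 3 (only parsing).
Local Notation aS := 4 (only parsing).
Local Notation aC := 5 (only parsing).
Local Notation aLab := 6 (only parsing).
Local Notation aTab := 7 (only parsing).
Local Notation aE := 8 (only parsing).

Definition for_each (i : nat) (c : cmd) : cmd :=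
  Set_ i (ECst 0) ;; Loop (ESub (EVar vN) (EVar i)) (c ;; Set_ i (EAdd (EVar i) (ECst 1))).

Definition visit_nbr : cmd :=
  Set_ vP (EAdd (EVar vP) (ECst 1)) ;;
  Set_ vK (ESub (EVar vK) (ECst 1)) ;;
  Set_ vW (EGet aIn (EVar vP)) ;;
  If (EGet aD (EVar vW)) Skip
    (Put aD (EVar vW) (EVar vDu) ;;
     Put aQ (EVar vTl) (EVar vW) ;;
     Set_ vTl (EAdd (EVar vTl) (ECst 1))).

Definition visit_head : cmd :=
  Set_ vU (EGet aQ (EVar vHd)) ;;
  Set_ vHd (EAdd (EVar vHd) (ECst 1)) ;;
  Set_ vP (EGet aOff (EVar vU)) ;;
  Set_ vK (EGet aIn (EVar vP)) ;;
  Set_ vDu (EAdd (EGet aD (EVar vU)) (ECst 1)) ;;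
  Loop (EVar vK) visit_nbr.

(* Array [aD] stores distances plus one, [0] meaning "not reached yet". *)
Definition bfs : cmd :=
  for_each vI (Put aD (EVar vI) (ECst 0)) ;;
  Put aD (EVar vSrc) (ECst 1) ;;
  Put aQ (ECst 0) (EVar vSrc) ;;
  Set_ vHd (ECst 0) ;;
  Set_ vTl (ECst 1) ;;
  Loop (ESub (EVar vTl) (EVar vHd)) visit_head.

(** [3 * n + 2] to clear the distances, 4 for the setup and [n * (8 * D + 7) + 1] for the main loop,
    with 8 per adjacency entry. *)
Definition bfs_cost (n D : nat) : nat := n * (8 * D + 10) + 7.

Section Neighbours.
Variables (n : nat) (e : rel 'I_n).

Lemma mem_nbrs (v u : 'I_n) : (val u \in nbrs e v) = e v u.
Proof. by rewrite /nbrs (mem_map val_inj) mem_filter mem_enum andbT. Qed.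

Lemma nth_nbrs (v : 'I_n) j : j < degree e v ->
  exists2 w : 'I_n, nth 0 (nbrs e v) j = val w & e v w.
Proof.
rewrite -size_nbrs => lt; have := mem_nth 0 lt.
case/mapP=> w; rewrite mem_filter => /andP[evw _] E.
by exists w.
Qed.

Lemma nbr_index (v w : 'I_n) : e v w ->
  exists2 j, j < degree e v & nth 0 (nbrs e v) j = val w.
Proof.
rewrite -mem_nbrs => wv; exists (index (val w) (nbrs e v)); last exact: nth_index.
by rewrite -size_nbrs index_mem.
Qed.

Lemma sorted_nbrs (v : 'I_n) : sorted ltn (nbrs e v).
Proof.
apply: (@subseq_sorted _ ltn _ _ (iota 0 n)); last exact: iota_ltn_sorted.
  by move=> ? ? ?; apply: ltn_trans.
by rewrite -val_enum_ord; apply: map_subseq; exact: filter_subseq.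
Qed.
End Neighbours.

Lemma wp_for_each n i c f (Inv : nat -> state -> Prop) s :
  ~~ writes_reg c vN -> ~~ writes_reg c i -> i != vN ->
  rg s vN = n ->
  (forall k s, k < n -> rg s vN = n -> rg s i = k -> Inv k s ->
     wp c (f k) (fun s' => Inv k.+1 (setr s' i k.+1)) s) ->
  Inv 0 (setr s i 0) ->
  wp (for_each i c) (\sum_(0 <= k < n) (f k + 2) + 2)
    (fun s' => rg s' vN = n /\ Inv n s') s.
Proof.
move=> cN ci iN sN step inv0.
pose Inv' k s := [/\ rg s vN = n, rg s i = k & Inv k s].
apply: (@wp_conseq _ (1 + (\sum_(0 <= k < n) (f k + 1).+1).+1) _ (Inv' n)) => [||s' [] //].
  apply: wp_seq; apply: wp_set; apply: (@wp_loop Inv') => //.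
  - move=> k s1 lt [s1N s1i s1inv]; split; first by rewrite /= s1N s1i subn_eq0 -ltnNge.
    apply: wp_seq; have := wp_frame (step k s1 lt s1N s1i s1inv).
    move/wp_conseq; apply => // s2 [inv2 [fr _]]; apply: wp_set => /=.
    have E2 := fr _ ci; rewrite s1i in E2.
    rewrite E2 addn1; split=> //=; last by rewrite /upd eqxx.
    by rewrite /upd eq_sym (negPf iN) fr.
  - by move=> s1 [s1N s1i _]; rewrite /= s1N s1i subnn.
  split=> //=; last by rewrite /upd eqxx.
  by rewrite /upd eq_sym (negPf iN).
rewrite add1n addn2 !ltnS; apply: leq_sum => k _; by rewrite addn1 addn2.
Qed.

Section BreadthFirst.
Variables (n : nat) (e : rel 'I_n) (D : nat).
Hypotheses (e_sym : symmetric e) (e_conn : gconnected e).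
Hypothesis deg_le : forall v, degree e v <= D.

(** Cell 0 of the copied input was lost to the scan and is not restored; [vN] takes its place. *)
Definition graph_ok (s : state) : Prop :=
  [/\ rg s vN = n, forall v : 'I_n, ar s aOff v = offset e v &
      forall i : nat, i != 0 -> ar s aIn i = input e i].

Lemma graph_ok_frame c s s' : graph_ok s -> frame c s s' ->
  ~~ [|| writes_reg c vN, writes_arr c aOff | writes_arr c aIn] -> graph_ok s'.
Proof.
move=> [sN sO sI] [fr fa]; rewrite !negb_or => /and3P[cN cO cI].
by split=> [|v|i i0]; rewrite ?fr ?fa ?sO ?sI.
Qed.

Variable src : 'I_n.
Local Notation d := (dist e src).

Definition queue_state (q : seq 'I_n) (s : state) : Prop :=
  [/\ forall v : 'I_n, ar s aD v = if v \in q then (d v).+1 else 0,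
      forall i, i < size q -> ar s aQ i = nth src q i & rg s vTl = size q].

(** The clause on [vU] keeps the vertex expanded last, which at the end is one farthest from
    [src]. *)
Definition outer_inv (hd : nat) (s : state) : Prop :=
  exists q, [/\ bfs_queue e src q hd, queue_state q s, graph_ok s,
    rg s vHd = hd & 0 < hd -> rg s vU = nth src q hd.-1].

Definition inner_inv (hd : nat) (u : 'I_n) (j : nat) (s : state) : Prop :=
  exists q, [/\ bfs_queue e src q hd, hd < size q /\ nth src q hd = u, queue_state q s,
    graph_ok s /\ rg s vHd = hd.+1 & [/\ rg s vU = u, rg s vP = offset e u + j,
      rg s vK = degree e u - j, rg s vDu = (d u).+2 &
      forall i (w : 'I_n), i < j -> nth 0 (nbrs e u) i = w -> w \in q]].

Lemma visit_nbrP hd u j s : j < degree e u -> inner_inv hd u j s ->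
  wp visit_nbr 7 (inner_inv hd u j.+1) s.
Proof.
move=> lj [q [bq [lq hu] [sD sQ sT] [[sN sO sI] sH] [sU sP sK sDu seen]]].
have [w wE euw] := nth_nbrs lj.
have off_gt : 0 < offset e u + j + 1 by rewrite addn1.
have inE' : ar s aIn (offset e u + j + 1) = w.
  rewrite sI -?lt0n // -wE addn1 -addnS input_offset //.
apply: (@wp_seq _ _ 1 6); apply: wp_set; apply: (@wp_seq _ _ 1 5); apply: wp_set.
apply: (@wp_seq _ _ 1 4); apply: wp_set; apply: (@wp_if _ _ _ 3) => /=;
  rewrite /upd /= sP inE' sD; case: ifP => wq // _.
  apply: wp_skip; exists q; rewrite /graph_ok /queue_state /= /upd /= ?sP ?sK ?inE'.
  split=> //; split=> //; [by rewrite addn1 addnS|by lia|].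
  move=> i x; rewrite ltnS leq_eqVlt => /predU1P[->|lt]; last exact: seen.
  by rewrite wE => /val_inj <-.
have [dw bq'] := bfs_queue_push e_conn bq lq (etrans (congr1 (e^~ w) hu) euw) (negbT wq).
apply: (@wp_seq _ _ 1 2); apply: wp_put; apply: (@wp_seq _ _ 1 1); apply: wp_put.
apply: wp_set; exists (rcons q w); rewrite /graph_ok /queue_state /= /upd /= ?sP ?sK ?inE' ?sT ?sDu.
rewrite hu in dw; split=> //.
- by rewrite size_rcons nth_rcons lq hu leqW.
- split=> [v|i|]; last by rewrite size_rcons addn1.
    rewrite mem_rcons inE -[val v == val w]/(v == w); case: eqP => [->|_] /=; first by rewrite dw.
    exact: sD.
  rewrite size_rcons ltnS nth_rcons leq_eqVlt; case: eqP => [->|ne] /=.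
    by rewrite ltnn.
  by move=> lt; rewrite lt sQ.
- split=> //; [by rewrite addn1 addnS|by lia|].
  move=> i x; rewrite mem_rcons inE ltnS leq_eqVlt => /predU1P[->|lt].
    by rewrite wE => /val_inj ->; rewrite eqxx.
  by move=> /(seen _ _ lt) ->; rewrite orbT.
Qed.

Lemma visit_headP hd s : hd < n -> outer_inv hd s ->
  wp visit_head (8 * D + 6) (outer_inv hd.+1) s.
Proof.
move=> lt [q [bq [sD sQ sT] [sN sO sI] sH _]].
have lq := bfs_queue_lt e_conn bq lt; set u := nth src q hd.
have uq : u \in q by apply: mem_nth.
have off0 : offset e u != 0 by [].
apply: (@wp_conseq _ (5 + (degree e u * 8).+1) _ (inner_inv hd u (degree e u))).
- do 5![apply: (@wp_seq _ _ 1); apply: wp_set].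
  apply: (@wp_loop_const (inner_inv hd u)).
  + move=> j s1 lj inv; split; last exact: visit_nbrP.
    by case: inv => q1 [_ _ _ _ [_ _ /= -> _ _]]; rewrite subn_eq0 -ltnNge.
  + by move=> s1 [q1 [_ _ _ _ [_ _ /= -> _ _]]]; rewrite subnn.
  exists q; rewrite /graph_ok /queue_state /= /upd /= sH sQ // -/u sO sI // sD uq.
  rewrite input_degree addn0 subn0 addn1 addn1; split=> //; split=> //.
- by have := deg_le u; lia.
move=> s1 [q1 [bq1 [lq1 hu] qs1 [g1 sH1] [sU1 _ _ _ seen]]].
exists q1; split=> //; last by rewrite /= hu.
apply: bfs_queue_pop => // w; rewrite hu => euw.
by have [j lj jw] := nbr_index euw; apply: seen jw.
Qed.

Lemma bfsP s : graph_ok s -> rg s vSrc = src -> wp bfs (bfs_cost n D)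
  (fun s' => [/\ frame bfs s s', graph_ok s', forall v : 'I_n, ar s' aD v = (d v).+1 &
     exists2 u : 'I_n, rg s' vU = u & d u = ecc e src]) s.
Proof.
move=> ok sS; have [sN sO sI] := ok.
have bound : (\sum_(0 <= k < n) (1 + 2) + 2) + (4 + (n * (8 * D + 6).+1).+1) = bfs_cost n D.
  by rewrite sum_nat_const_nat subn0 /bfs_cost; lia.
have main : wp bfs (bfs_cost n D) (outer_inv n) s; last first.
  apply: (wp_conseq (wp_frame main)) => // s' [[q [bq [sD sQ sT] ok' sH sU]] fr]; split=> //.
    have full : q =i predT.
      by apply: (bfs_queue_full e_conn bq); exact: bfs_queue_size bq.
    by move=> v; rewrite sD full.
  have n0 : 0 < n by case: (n) src => [[]|].
  by exists (nth src q n.-1); [exact: sU|exact: (bfs_queue_last e_conn bq)].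
rewrite -bound /bfs; apply: wp_seq.
pose Inv k s' := forall i, i < k -> ar s' aD i = 0.
have init := @wp_for_each n vI (Put aD (EVar vI) (ECst 0)) (fun=> 1) Inv s isT isT isT sN.
apply: (wp_conseq (wp_frame (init _ _))) => //.
  move=> k s1 lk s1N s1I inv; apply: wp_put => i; rewrite /= /upd s1I ltnS leq_eqVlt.
  by case: eqP => //= _; exact: inv.
move=> s1 [[s1N inv] fr1]; have ok1 := graph_ok_frame ok fr1 isT.
have s1S : rg s1 vSrc = src by case: fr1 => ->.
have s1D (v : 'I_n) : ar s1 aD v = 0 by apply: inv.
do 2![apply: (@wp_seq _ _ 1); apply: wp_put]; do 2![apply: (@wp_seq _ _ 1); apply: wp_set].
apply: (@wp_loop_const outer_inv).
- move=> hd s2 lt inv2; split; last exact: visit_headP.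
  case: inv2 => q [bq [_ _ sT] _ sH _]; rewrite /= sT sH subn_eq0 -ltnNge.
  exact: (bfs_queue_lt e_conn bq lt).
- move=> s2 [q [bq [_ _ sT] _ sH _]]; rewrite /= sT sH; apply/eqP.
  by rewrite subn_eq0; apply: bfs_queue_size bq.
exists [:: src]; case: ok1 => o1 o2 o3.
rewrite /graph_ok /queue_state /= /upd /= s1S; split=> //; first exact: bfs_queue_init.
split=> // [v|[|i] //]; rewrite inE -[val v == val src]/(v == src).
by case: eqP => [->|_] //=; rewrite dist0.
Qed.

End BreadthFirst.

(** * Computing the eccentricities *)

Lemma wp_for_ord n i c (f : 'I_n -> nat) (Inv : nat -> state -> Prop) s :
  ~~ writes_reg c vN -> ~~ writes_reg c i -> i != vN -> rg s vN = n ->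
  (forall (x : 'I_n) s, rg s vN = n -> rg s i = x -> Inv x s ->
     wp c (f x) (fun s' => Inv x.+1 (setr s' i x.+1)) s) ->
  Inv 0 (setr s i 0) ->
  wp (for_each i c) (\sum_x (f x + 2) + 2) (fun s' => rg s' vN = n /\ Inv n s') s.
Proof.
move=> cN ci iN sN step inv0; pose f' k := if insub k is Some x then f x else 0.
have -> : \sum_x (f x + 2) = \sum_(0 <= k < n) (f' k + 2).
  by rewrite big_mkord; apply: eq_bigr => x _; rewrite /f' valK.
apply: wp_for_each => // k s1 lt s1N s1i inv.
by rewrite /f' (insubT (fun k => k < n) lt); exact: (step (Ordinal lt)).
Qed.

(** * Recovering the offsets, [n] and the lost cell 2 *)

Definition parse : cmd :=
  Put aOff (ECst 0) (ECst 1) ;;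
  Set_ vP (EAdd (EGet aIn (ECst 1)) (ECst 2)) ;;
  Set_ vI (ECst 1) ;;
  Loop (ESub (EVar vL) (EVar vP)) (
    Put aOff (EVar vI) (EVar vP) ;;
    If (EGet aIn (EAdd (EVar vP) (ECst 1))) Skip
      (If (EGet aIn (ECst 2)) Skip (Put aIn (ECst 2) (EVar vI))) ;;
    Set_ vP (EAdd (EAdd (EVar vP) (EGet aIn (EVar vP))) (ECst 1)) ;;
    Set_ vI (EAdd (EVar vI) (ECst 1))) ;;
  Set_ vN (EVar vI).

Section Parsing.
Variables (n : nat) (e : rel 'I_n).
Hypotheses (e_sym : symmetric e) (e_irr : irreflexive e) (e_conn : gconnected e).
Hypothesis n_gt0 : 0 < n.
Let v0 : 'I_n := Ordinal n_gt0.

Lemma head_nbrs_le (v w : 'I_n) : e v w -> nth 0 (nbrs e v) 0 <= w.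
Proof.
rewrite -mem_nbrs; have := sorted_nbrs e v; case: (nbrs e v) => //= h t pt.
rewrite inE => /predU1P[->//|wt]; apply: ltnW.
by have /allP := order_path_min ltn_trans pt; exact.
Qed.

Lemma input_first (v : 'I_n) : 0 < degree e v ->
  exists2 w : 'I_n, input e (offset e v + 1) = w & e v w.
Proof.
move=> dv; have [w wE evw] := nth_nbrs dv.
by exists w => //; rewrite input_offset.
Qed.

(* Cell 2 of the input, the first neighbour of vertex 0, is not available: it
   is the first vertex whose list of neighbours starts with 0. *)
Definition parse_inv (k : nat) (s : state) : Prop :=
  [/\ rg s vP = offset e k /\ rg s vI = k, rg s vL = offset e n,
      forall v : 'I_n, v < k -> ar s aOff v = offset e v,
      forall i : nat, i != 0 -> i != 2 -> ar s aIn i = input e i &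
      ar s aIn 2 = if input e 2 < k then input e 2 else 0].

(** Neighbour lists are increasing, so the list of [k] starts with 0 exactly when [k] is adjacent to
    0. The value 0 in cell 2 can mean that nothing has been found yet, because 0 is not its own
    neighbour. *)
Lemma parse_step k s : 0 < k < n -> parse_inv k s ->
  wp (Put aOff (EVar vI) (EVar vP) ;;
    If (EGet aIn (EAdd (EVar vP) (ECst 1))) Skip
      (If (EGet aIn (ECst 2)) Skip (Put aIn (ECst 2) (EVar vI))) ;;
    Set_ vP (EAdd (EAdd (EVar vP) (EGet aIn (EVar vP))) (ECst 1)) ;;
    Set_ vI (EAdd (EVar vI) (ECst 1))) 6 (parse_inv k.+1) s.
Proof.
case/andP=> k0 kn [[sP sI] sL sO sIn s2]; pose v : 'I_n := Ordinal kn.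
have n1 : 1 < n by lia.
have [h hE e0h] := input_first (degree_gt0 n_gt0 e_conn v0 n1).
rewrite /= offset0 in hE.
have [w wE evw] := input_first (degree_gt0 n_gt0 e_conn v n1).
have o3 : 2 < offset e k.
  have := offset_mono e k0; have := offsetS e v0; rewrite /= offset0.
  by have := degree_gt0 n_gt0 e_conn v0 n1; lia.
have wE' : ar s aIn (offset e k + 1) = w by rewrite sIn ?wE //; lia.
have dE : ar s aIn (offset e k) = degree e v by rewrite sIn ?(input_degree e v) //; lia.
have oS : offset e k.+1 = offset e k + degree e v + 1 := offsetS e v.
have tail (s' : state) : rg s' vP = offset e k -> rg s' vI = k -> rg s' vL = offset e n ->
    (forall v : 'I_n, v < k.+1 -> ar s' aOff v = offset e v) ->
    (forall i : nat, i != 0 -> i != 2 -> ar s' aIn i = input e i) ->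
    ar s' aIn 2 = (if input e 2 < k.+1 then input e 2 else 0) ->
    wp (Set_ vP (EAdd (EAdd (EVar vP) (EGet aIn (EVar vP))) (ECst 1)) ;;
        Set_ vI (EAdd (EVar vI) (ECst 1))) 2 (parse_inv k.+1) s'.
  move=> tP tI tL tO tIn t2; apply: (@wp_seq _ _ 1 1); apply: wp_set; apply: wp_set.
  have dE' : ar s' aIn (offset e k) = degree e v by rewrite tIn ?(input_degree e v) //; lia.
  by rewrite /parse_inv /= /upd /= tP tI dE' -oS addn1.
apply: (@wp_seq _ _ 1 5); apply: wp_put; apply: (@wp_seq _ _ 3 2).
have sO' u : u < k.+1 -> upd (ar s aOff) k (offset e k) u = offset e u.
  rewrite /upd ltnS leq_eqVlt; case: eqP => [->//|_] /=.
  by move=> lt; have := sO (Ordinal (ltn_trans lt kn)) lt.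
apply: wp_if; rewrite /= sP sI wE' => w0.
  apply: wp_skip; apply: tail => //= [u|]; first exact: sO'.
  rewrite s2.
  have -> // : (input e 2 < k.+1) = (input e 2 < k).
  rewrite ltnS leq_eqVlt hE; case: eqP => // hk; case/negP: w0.
  have hv : h = v by apply: val_inj.
  have := @head_nbrs_le v v0; rewrite e_sym -{1}hv e0h => /(_ isT).
  have := input_offset (e := e) (v := v) (j := 1) (degree_gt0 n_gt0 e_conn v n1).
  by rewrite wE /= => ->; rewrite leqn0.
have e0v : e v0 v.
  by rewrite e_sym; have -> : v0 = w by apply: val_inj.
have hk : h <= k.
  have := head_nbrs_le e0v; have := input_offset (e := e) (v := v0) (j := 1).
  by rewrite /= offset0 => <- //; [rewrite hE|exact: degree_gt0].
apply: wp_if; rewrite /= s2 => in2.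
  apply: wp_skip; apply: tail => //= [u|]; first exact: sO'.
  rewrite s2.
  by move: in2; case: ltnP => // lt _; rewrite (leq_trans lt (leqnSn k)).
apply: wp_put; apply: tail => //= [u|i i0 i2|]; first exact: sO'.
  by rewrite /upd (negPf i2) sIn.
rewrite /upd /= sI hE ltnS hk; apply/eqP; rewrite eqn_leq hk andbT leqNgt.
apply/negP => hltk; move: in2; rewrite hE hltk => h0.
have : h = v0 by apply: val_inj.
by move=> hv0; rewrite hv0 e_irr in e0h.
Qed.

Lemma parseP s : rg s vL = offset e n ->
  (forall i : nat, i != 0 -> i != 2 -> ar s aIn i = input e i) -> ar s aIn 2 = 0 ->
  wp parse (7 * n + 5) (graph_ok e) s.
Proof.
move=> sL sIn s2.
suff main : wp parse (3 + ((\sum_(1 <= i < n) 7).+1 + 1)) (graph_ok e) s.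
  by apply: (wp_conseq main) => //; rewrite sum_nat_const_nat; lia.
rewrite /parse; apply: (@wp_seq _ _ 1 (2 + _)); apply: wp_put.
apply: (@wp_seq _ _ 1 (1 + _)); apply: wp_set; apply: (@wp_seq _ _ 1 _); apply: wp_set.
apply: wp_seq; set s1 := setr _ _ _.
have inv1 : 0 < 1 /\ parse_inv 1 s1.
  split=> //; rewrite /parse_inv /= /upd /= sL s2 sIn // offset1 //; split=> //.
    by move=> [[|v] lv] //= _; rewrite offset0.
  by case: (input e 2).
have loop := wp_loop (f := fun=> 6) (Inv := fun k s => 0 < k /\ parse_inv k s) _ _ n_gt0 inv1.
apply: (wp_conseq (loop _ _ _ _)) => //.
- move=> k s3 lt [k0 inv]; split; last first.
    have ltk : 0 < k < n by rewrite k0.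
    by apply: (wp_conseq (parse_step ltk inv)).
  case: inv => [[sP3 _] sL3 _ _ _]; rewrite /= sP3 sL3 subn_eq0 -ltnNge.
  have := offset_mono e lt; have := offsetS e (Ordinal lt); rewrite /=; lia.
- by move=> s3 [_ [[sP3 _] sL3 _ _ _]]; rewrite /= sP3 sL3 subnn.
move=> s4 [_ [[sP4 sI4] sL4 sO4 sIn4 s24]]; apply: wp_set; rewrite /graph_ok /= /upd /= sI4.
split=> // [v|i i0]; first exact: sO4.
have [->|i2] := eqVneq i 2; last exact: sIn4.
rewrite s24; case: ifP => // /negbT; rewrite -leqNgt => le.
(* [n <= input e 2] is possible only for [n = 1], when cell 2 is past the input and reads 0. *)
have [n1|n1] := leqP n 1.
  have dv0 : degree e v0 = 0.
    apply: eq_card0 => x; rewrite inE; have -> : x = v0 by apply: val_inj; case: x => /=; lia.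
    exact: e_irr.
  have nE : n = 1 by lia.
  by rewrite input_end // (congr1 (offset e) nE) (offsetS e v0) offset0 dv0.
have [h hE e0h] := input_first (degree_gt0 n_gt0 e_conn v0 n1).
rewrite /= offset0 in hE; move: le.
by rewrite -[2]/(1 + 1) hE leqNgt ltn_ord.
Qed.
End Parsing.

(** * The phases of the algorithm *)

Definition copy_dist (a : nat) : cmd := for_each vI (Put a (EVar vI) (EGet aD (EVar vI))).

(** A sum of truncated differences is 0 exactly when all of them are. In true distances they are the
    excess over a geodesic, [ecc e y - 2 * d y v] and [2 * d y v - ecc e y - 1]; the constants also
    compensate for storing distances plus one. *)
Definition off_center : expr :=
  EAdd (EAdd (ESub (EAdd (EGet aS (EVar vI)) (EGet aD (EVar vI))) (EAdd (EVar vT) (ECst 1)))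
    (ESub (EAdd (EVar vH) (ECst 1)) (EAdd (EGet aD (EVar vI)) (EGet aD (EVar vI)))))
    (ESub (EAdd (EGet aD (EVar vI)) (EGet aD (EVar vI))) (EAdd (EVar vH) (ECst 2))).

Definition find_center : cmd :=
  Set_ vSrc (ECst 0) ;; bfs ;; Set_ vT (EGet aD (EVar vU)) ;; copy_dist aS ;;
  Set_ vSrc (EVar vU) ;; bfs ;; Set_ vH (EGet aD (EVar vU)) ;;
  for_each vI (If off_center Skip (Set_ vC (EVar vI))) ;;
  Set_ vSrc (EVar vC) ;; bfs ;; copy_dist aC.

(** The same 6 as the radius [k] for which [ecc_class] is proved. *)
Definition ball_radius := 6.

(** The search from a ball vertex appends one binary digit to the labels of all vertices: 0 when the
    detour through [vX] is longer than a geodesic from the centre, 1 otherwise. *)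
Definition label_ball : cmd :=
  for_each vX (If (ESub (EGet aC (EVar vX)) (ECst ball_radius.+1)) Skip
    (Set_ vSrc (EVar vX) ;; bfs ;;
     for_each vI (If (ESub (EAdd (EGet aC (EVar vX)) (EGet aD (EVar vI)))
                        (EAdd (EGet aC (EVar vI)) (ECst 1)))
       (Put aLab (EVar vI) (EAdd (EGet aLab (EVar vI)) (EGet aLab (EVar vI))))
       (Put aLab (EVar vI) (EAdd (EAdd (EGet aLab (EVar vI)) (EGet aLab (EVar vI))) (ECst 1)))))).

(** The label is used directly as an index into [aTab], which holds [ecc v - d(c, v) + 1] so that 0
    can mark a class not met before. The difference does not truncate since [d(c, v) <= ecc v]. The
    final 2 removes this 1 and the one in [aC]. *)
Definition solve_classes : cmd :=
  for_each vX (
    If (EGet aTab (EGet aLab (EVar vX))) Skip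
      (Set_ vSrc (EVar vX) ;; bfs ;;
       Put aTab (EGet aLab (EVar vX))
         (EAdd (ESub (EGet aD (EVar vU)) (EGet aC (EVar vX))) (ECst 1))) ;;
    Put aE (EVar vX)
      (ESub (EAdd (EGet aTab (EGet aLab (EVar vX))) (EGet aC (EVar vX))) (ECst 2))).

(* The last command prepares cell 0 for [postlude], which returns
   [E 0 - E 1] there. *)
Definition eccentricities : cmd :=
  parse ;; find_center ;; label_ball ;; solve_classes ;;
  Put aE (ECst 0) (EAdd (EGet aE (ECst 0)) (EGet aE (ECst 1))).

Section Phases.
Variables (n : nat) (e : rel 'I_n) (D : nat).
Hypotheses (e_sym : symmetric e) (e_conn : gconnected e) (e_chordal : chordal e).
Hypothesis deg_le : forall v, degree e v <= D.
Hypothesis n_gt0 : 0 < n.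
Local Notation d := (dist e).
Local Notation b := (bfs_cost n D).

Lemma graph_ok_setr s r x : graph_ok e s -> r != vN -> graph_ok e (setr s r x).
Proof. by move=> [sN sO sI] r0; split=> //=; rewrite /upd eq_sym (negPf r0). Qed.

Lemma copy_distP a s : a != aD -> graph_ok e s ->
  wp (copy_dist a) (3 * n + 2) (fun s' => forall v : 'I_n, ar s' a v = ar s aD v) s.
Proof.
move=> aD' [sN _ _].
pose Inv k s' := ar s' aD = ar s aD /\ forall v : 'I_n, v < k -> ar s' a v = ar s aD v.
have -> : 3 * n + 2 = \sum_(x : 'I_n) (1 + 2) + 2 by rewrite sum_nat_const card_ord mulnC.
have main : wp (copy_dist a) (\sum_(x : 'I_n) (1 + 2) + 2) (fun s' => rg s' vN = n /\ Inv n s') s;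
  last by apply: (wp_conseq main) => // s' [_ [_ H]] v; exact: H.
apply: (@wp_for_ord n vI _ (fun=> 1) Inv) => // x s1 s1N s1I [E inv]; apply: wp_put; split=> [|v] /=.
  by rewrite eq_sym (negPf aD').
rewrite eqxx s1I /upd ltnS leq_eqVlt -[val v == val x]/(v == x).
by case: eqP => [->|_] /=; [rewrite E|exact: inv].
Qed.

Definition on_middle (s y v : 'I_n) : bool :=
  [&& d s v + d v y == d s y, 2 * d y v - ecc e y <= 1 & ecc e y <= 2 * d y v].

Lemma search_centerP s (x y : 'I_n) : graph_ok e s -> d x y = ecc e x ->
  (forall v : 'I_n, ar s aS v = (d x v).+1) -> (forall v : 'I_n, ar s aD v = (d y v).+1) ->
  rg s vT = (d x y).+1 -> rg s vH = (ecc e y).+1 ->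
  wp (for_each vI (If off_center Skip (Set_ vC (EVar vI)))) (4 * n + 2)
    (fun s' => exists2 c : 'I_n, rg s' vC = c & on_middle x y c) s.
Proof.
move=> [sN _ _] dxy sS sD sT sH.
pose Inv k s' := [/\ ar s' = ar s, rg s' vT = (d x y).+1, rg s' vH = (ecc e y).+1 &
  (exists2 c : 'I_n, rg s' vC = c & on_middle x y c) \/
  forall v : 'I_n, v < k -> ~~ on_middle x y v].
have -> : 4 * n + 2 = \sum_(x : 'I_n) (2 + 2) + 2 by rewrite sum_nat_const card_ord mulnC.
set c0 := for_each _ _.
have main : wp c0 (\sum_(x : 'I_n) (2 + 2) + 2) (fun s' => rg s' vN = n /\ Inv n s') s; last first.
  apply: (wp_conseq main) => // s' [_ [_ _ _ [//|none]]]; have [c c1 [c2 c3]] := exists_middle e_sym e_conn dxy.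
  by have := none c (ltn_ord c); rewrite /on_middle c1 eqxx c2 c3.
apply: (@wp_for_ord n vI _ (fun=> 2) Inv) => // [v s1 s1N s1I [s1A s1T s1H inv]|]; last first.
  by split=> //; right.
have evE : (eval s1 off_center == 0) = on_middle x y v.
  rewrite /= s1I s1T s1H s1A sS sD /on_middle (dist_sym e_sym e_conn v y).
  have := dist_triangle e_conn v x y; rewrite (dist_sym e_sym e_conn v y) => tri'.
  by apply/idP/and3P => [/eqP|[/eqP]]; [split|]; lia.
apply: wp_if => [nz|z].
  apply: wp_skip; split=> //.
  case: inv => [?|none]; [by left|right] => w; rewrite ltnS leq_eqVlt.
  by move=> /predU1P[/val_inj->|]; [rewrite -evE|exact: none].
by apply: wp_set; split=> //; left; exists v => //; rewrite -evE z.
Qed.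

Definition center_cost := 3 * b + 10 * n + 13.

Lemma find_centerP s : graph_ok e s -> wp find_center center_cost
  (fun s' => graph_ok e s' /\ exists2 c : 'I_n, (forall x, ecc e c <= ecc e x + 3) &
     forall v : 'I_n, ar s' aC v = (d c v).+1) s.
Proof.
move=> ok; pose v0 : 'I_n := Ordinal n_gt0.
suff main : wp find_center (1 + (b + (1 + ((3 * n + 2) + (1 + (b + (1 + ((4 * n + 2) +
    (1 + (b + (3 * n + 2)))))))))))
  (fun s' => graph_ok e s' /\ exists2 c : 'I_n, (forall x, ecc e c <= ecc e x + 3) &
     forall v : 'I_n, ar s' aC v = (d c v).+1) s.
  by apply: (wp_conseq main) => //; rewrite /center_cost; lia.
apply: wp_seq; apply: wp_set; apply: wp_seq.
have ok1 := graph_ok_setr 0 ok (isT : vSrc != vN).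
apply: (wp_conseq (bfsP e_conn deg_le (src := v0) ok1 _)) => // s1 [_ {}ok1 s1D [y s1U dy]].
apply: wp_seq; apply: wp_set; apply: wp_seq; rewrite /= s1U s1D.
have ok2 := graph_ok_setr (d v0 y).+1 ok1 (isT : vT != vN).
apply: (wp_conseq (wp_frame (copy_distP (a := aS) isT ok2))) => // s2 [s2S fr2].
have {}ok2 := graph_ok_frame ok2 fr2 isT.
have s2T : rg s2 vT = (d v0 y).+1 by rewrite (fr2.1 vT).
have s2U : rg s2 vU = y by rewrite (fr2.1 vU).
have {}s2S (v : 'I_n) : ar s2 aS v = (d v0 v).+1 by rewrite s2S /= s1D.
apply: wp_seq; apply: wp_set; apply: wp_seq; rewrite /= s2U.
have ok3 := graph_ok_setr y ok2 (isT : vSrc != vN).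
apply: (wp_conseq (bfsP e_conn deg_le (src := y) ok3 _)) => // s3 [fr3 {}ok3 s3D [z s3U dz]].
have s3T : rg s3 vT = (d v0 y).+1 by rewrite (fr3.1 vT).
have s3S (v : 'I_n) : ar s3 aS v = (d v0 v).+1 by rewrite (fr3.2 aS) //= s2S.
apply: wp_seq; apply: wp_set; apply: wp_seq; rewrite /= s3U s3D dz.
have ok4 := graph_ok_setr (ecc e y).+1 ok3 (isT : vH != vN).
apply: (wp_conseq (wp_frame (search_centerP ok4 dy _ _ _ _))) => //.
move=> s4 [[c s4C mid] fr4]; have {}ok4 := graph_ok_frame ok4 fr4 isT.
apply: wp_seq; apply: wp_set; apply: wp_seq; rewrite /= s4C.
have ok5 := graph_ok_setr c ok4 (isT : vSrc != vN).
apply: (wp_conseq (bfsP e_conn deg_le (src := c) ok5 _)) => // s5 [fr5 {}ok5 s5D _].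
apply: (wp_conseq (wp_frame (copy_distP (a := aC) isT ok5))) => // s6 [s6C fr6].
split; first exact: graph_ok_frame ok5 fr6 isT.
exists c => [x|v]; last by rewrite s6C s5D.
by case/and3P: mid => /eqP m1 m2 m3; exact: (middle_ecc e_sym e_conn e_chordal dy m1 m2 m3).
Qed.

Section Labels.
Variable c : 'I_n.

Definition between (x v : 'I_n) : bool := d c x + d x v == d c v.

(* The binary digits of [label v n] tell which vertices of the ball lie between
   [c] and [v]. *)
Fixpoint label (v : 'I_n) (k : nat) : nat :=
  if k is k'.+1 then
    if insub k' is Some x then
      if d c x <= ball_radius then (label v k').*2 + between x v else label v k'
    else label v k'
  else 0.

Lemma labelS (v x : 'I_n) : label v x.+1 =
  if d c x <= ball_radius then (label v x).*2 + between x v else label v x.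
Proof. by rewrite /= valK. Qed.

Arguments label : simpl never.

(** Which positions contribute a digit depends only on [c], so the labels of different vertices
    align and equal numbers have equal digits. *)
Lemma label_inj v v' : label v n = label v' n ->
  forall x, d c x <= ball_radius -> between x v = between x v'.
Proof.
suff H k : k <= n -> label v k = label v' k -> forall x : 'I_n, x < k ->
    d c x <= ball_radius -> between x v = between x v'.
  by move=> E x; exact: (H n (leqnn n) E x (ltn_ord x)).
elim: k => // k IH lt; have := labelS v (Ordinal lt); have := labelS v' (Ordinal lt).
move=> /= -> ->; case: ifP => [le E|gt E] x.
  have [E1 E2] : label v k = label v' k /\ between (Ordinal lt) v = between (Ordinal lt) v'.
    by move: E; case: between; case: between => E; split => //; lia.
  rewrite ltnS leq_eqVlt => /predU1P[xk _|]; last exact: IH (ltnW lt) E1 x.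
  by have -> : x = Ordinal lt by apply: val_inj.
rewrite ltnS leq_eqVlt => /predU1P[xk|]; last exact: IH (ltnW lt) E x.
by have -> : x = Ordinal lt by [apply: val_inj]; rewrite gt.
Qed.

Lemma label_bound v : label v n < 2 ^ #|[set x | d c x <= ball_radius]|.
Proof.
pose B k := [set x : 'I_n | (d c x <= ball_radius) && (x < k)].
suff H k : k <= n -> label v k < 2 ^ #|B k|.
  have -> : [set x | d c x <= ball_radius] = B n; last exact: H.
  by apply/setP => x; rewrite !inE ltn_ord andbT.
elim: k => [|k IH] lt; first by rewrite expn_gt0.
have := IH (ltnW lt); have := labelS v (Ordinal lt) => /= ->; case: ifP => le IHk.
  have -> : B k.+1 = Ordinal lt |: B k.
    apply/setP => x; rewrite !inE ltnS [x <= k]leq_eqVlt andb_orr.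
    rewrite -[x == Ordinal lt]/(val x == k); case: eqP => xk; rewrite ?andbF //= andbT.
    by have -> : x = Ordinal lt by [apply: val_inj]; rewrite le.
  rewrite cardsU1 inE /= ltnn andbF /= expnD expn1.
  by case: between => /=; lia.
have -> // : B k.+1 = B k.
apply/setP => x; rewrite !inE ltnS [x <= k]leq_eqVlt andb_orr.
case: eqP => xk; rewrite ?andbF //= andbT.
by have -> : x = Ordinal lt by [apply: val_inj]; rewrite le.
Qed.

Definition label_cost := D.+1 ^ ball_radius * (b + 4 * n + 3) + 3 * n + 2.

Lemma label_ballP s : graph_ok e s -> (forall v : 'I_n, ar s aC v = (d c v).+1) ->
  (forall v : 'I_n, ar s aLab v = 0) ->
  wp label_ball label_cost (fun s' => forall v : 'I_n, ar s' aLab v = label v n) s.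
Proof.
move=> ok sC sLab; have [sN _ _] := ok.
(* A search is charged only to vertices of the ball, so the total splits into a linear term and a
   multiple of the ball size. *)
pose f (x : 'I_n) := 1 + (if d c x <= ball_radius then b + 4 * n + 3 else 0).
pose Inv k s' := [/\ graph_ok e s', forall v : 'I_n, ar s' aC v = (d c v).+1 &
   forall v : 'I_n, ar s' aLab v = label v k].
have main : wp label_ball (\sum_x (f x + 2) + 2) (fun s' => rg s' vN = n /\ Inv n s') s;
  last first.
  apply: (wp_conseq main) => [|s' [_ []] //].
  have -> : \sum_x (f x + 2) = \sum_(x : 'I_n) 3 +
      \sum_(x : 'I_n | d c x <= ball_radius) (b + 4 * n + 3).
    rewrite [X in _ = _ + X]big_mkcond -big_split; apply: eq_bigr => x _; rewrite /f /=; lia.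
  rewrite !sum_nat_const card_ord; have := ball_card e_sym e_conn ball_radius c deg_le.
  rewrite cardsE /label_cost => le.
  have := leq_mul le (leqnn (b + 4 * n + 3)); lia.
apply: (@wp_for_ord n vX _ f Inv) => // x s1 s1N s1X [ok1 s1C s1L].
rewrite /f add1n; apply: wp_if; rewrite /= s1X s1C.
  move=> gt; have nle : (d c x <= ball_radius) = false.
    by apply/negbTE; move: gt; rewrite /ball_radius; lia.
  rewrite nle.
  apply: wp_skip; split=> // v.
  by rewrite labelS nle -s1L.
move=> z; have le : d c x <= ball_radius by move: z; rewrite /ball_radius; lia.
rewrite le; have -> : b + 4 * n + 3 = 1 + (b + (4 * n + 2)) by lia.
apply: wp_seq; apply: wp_set; apply: wp_seq; rewrite /= s1X.
have ok2 := graph_ok_setr x ok1 (isT : vSrc != vN).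
apply: (wp_conseq (bfsP e_conn deg_le (src := x) ok2 _)) => // s2 [fr2 {}ok2 s2D _].
have s2N : rg s2 vN = n by case: ok2.
pose Inv2 k s' := [/\ graph_ok e s', rg s' vX = x, forall v : 'I_n, ar s' aC v = (d c v).+1,
   forall v : 'I_n, ar s' aD v = (d x v).+1 &
   forall v : 'I_n, ar s' aLab v = if v < k then label v x.+1 else label v x].
set c0 := for_each _ _.
have inner : wp c0 (\sum_(y : 'I_n) (2 + 2) + 2) (fun s' => rg s' vN = n /\ Inv2 n s') s2;
  last first.
  apply: (wp_conseq inner); first by rewrite sum_nat_const card_ord mulnC.
  move=> s3 [_ [ok3 _ s3C _ s3L]]; split=> // v.
  by rewrite s3L ltn_ord.
apply: (@wp_for_ord n vI _ (fun=> 2) Inv2) => //; last first.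
  split=> //= [|v|v]; first by rewrite /upd /= (fr2.1 vX).
    by rewrite (fr2.2 aC) //= s1C.
  by rewrite (fr2.2 aLab) //= s1L.
move=> y s3 s3N s3I [ok3 s3X s3C s3D s3L].
have stepP bit : (bit == between x y) ->
    Inv2 y.+1 (setr (seta s3 aLab y ((label y x).*2 + bit)) vI y.+1).
  move=> /eqP->; split=> //= v; rewrite /upd ltnS leq_eqVlt -[val v == val y]/(v == y).
  by case: eqP => [->|_] /=; [rewrite labelS le|rewrite s3L].
apply: wp_if; rewrite /= s3X s3I s3C s3C s3D => E; apply: wp_put; rewrite /= s3I s3L ltnn addnn.
  have := @stepP false; rewrite addn0; apply; rewrite eq_sym eqbF_neg /between.
  by move: E; lia.
apply: (@stepP true); rewrite eq_sym eqb_id /between.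
by have := dist_triangle e_conn x c y; lia.
Qed.

End Labels.

Section Solving.
Variable c : 'I_n.
Hypothesis c_central : forall x, ecc e c <= ecc e x + 3.
Local Notation lab v := (label c v n).

Lemma ecc_label v v' : lab v = lab v' -> ecc e v + d c v' = ecc e v' + d c v.
Proof.
move=> E; apply: (ecc_class e_sym e_conn e_chordal c_central) => a la.
exact: (label_inj E la).
Qed.

(** These are the vertices for which [solve_classes] runs a search; their labels being distinct, the
    bound on labels bounds their number. *)
Definition new_class (x : 'I_n) : bool := [forall y : 'I_n, (y < x) ==> (lab y != lab x)].

Lemma new_class_card : #|new_class| <= 2 ^ (D.+1 ^ ball_radius).
Proof.
have le := ball_card e_sym e_conn ball_radius c deg_le.
apply: (@leq_trans (2 ^ #|[set x | d c x <= ball_radius]|)); last by rewrite leq_exp2l.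
set M := 2 ^ _.
suff: size [seq lab x | x <- enum new_class] <= size (iota 0 M).
  by rewrite size_map size_iota -cardE.
apply: uniq_leq_size => [|l /mapP[x _ ->]]; last by rewrite mem_iota label_bound.
rewrite map_inj_in_uniq ?enum_uniq // => x y; rewrite !mem_enum.
move=> /forallP nx /forallP ny E; apply: val_inj.
have [lt|lt|//] := ltngtP (val x) (val y).
  by have := ny x; rewrite lt E eqxx.
by have := nx y; rewrite lt E eqxx.
Qed.

Definition class_cost := 2 ^ (D.+1 ^ ball_radius) * (b + 2) + 4 * n + 2.

Lemma solve_classesP s : graph_ok e s -> (forall v : 'I_n, ar s aC v = (d c v).+1) ->
  (forall v : 'I_n, ar s aLab v = lab v) -> (forall l, ar s aTab l = 0) ->
  wp solve_classes class_cost (fun s' => forall v : 'I_n, ar s' aE v = ecc e v) s.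
Proof.
move=> ok sC sL sT; have [sN _ _] := ok.
pose f (x : 'I_n) := (1 + (if new_class x then b + 2 else 0)) + 1.
pose Inv k s' := [/\ graph_ok e s', forall v : 'I_n, ar s' aC v = (d c v).+1,
   forall v : 'I_n, ar s' aLab v = lab v &
   [/\ forall v : 'I_n, v < k -> ar s' aTab (lab v) = ecc e v - d c v + 1,
     forall l : nat, (forall v : 'I_n, v < k -> lab v != l) -> ar s' aTab l = 0 &
     forall v : 'I_n, v < k -> ar s' aE v = ecc e v]].
have dle v : d c v <= ecc e v by rewrite (dist_sym e_sym e_conn) ecc_ge.
have main : wp solve_classes (\sum_x (f x + 2) + 2) (fun s' => rg s' vN = n /\ Inv n s') s;
  last first.
  apply: (wp_conseq main) => [|s' [_ [_ _ _ [_ _ sE]]] v]; last exact: sE.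
  have -> : \sum_x (f x + 2) = \sum_(x : 'I_n) 4 + \sum_(x : 'I_n | new_class x) (b + 2).
    rewrite [X in _ = _ + X]big_mkcond -big_split; apply: eq_bigr => x _; rewrite /f /=; lia.
  rewrite !sum_nat_const card_ord /class_cost [n * 4]mulnC [4 * n + _]addnC.
  by rewrite !leq_add2r leq_mul2r new_class_card orbT.
apply: (@wp_for_ord n vX _ f Inv) => // [x s1 s1N s1X [ok1 s1C s1L [s1T s1T0 s1E]]|];
  last by split=> //; split=> // l _; exact: sT.
have finish s2 : graph_ok e s2 -> rg s2 vX = x -> (forall v : 'I_n, ar s2 aC v = (d c v).+1) ->
    (forall v : 'I_n, ar s2 aLab v = lab v) ->
    (forall v : 'I_n, v < x.+1 -> ar s2 aTab (lab v) = ecc e v - d c v + 1) ->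
    (forall l : nat, (forall v : 'I_n, v < x.+1 -> lab v != l) -> ar s2 aTab l = 0) ->
    (forall v : 'I_n, v < x -> ar s2 aE v = ecc e v) ->
    wp (Put aE (EVar vX)
      (ESub (EAdd (EGet aTab (EGet aLab (EVar vX))) (EGet aC (EVar vX))) (ECst 2))) 1
     (fun s' => Inv x.+1 (setr s' vX x.+1)) s2.
  move=> ok2 s2X s2C s2L s2T s2T0 s2E; apply: wp_put; rewrite /= s2X s2L s2C s2T //.
  have -> : ecc e x - d c x + 1 + (d c x).+1 - 2 = ecc e x by have := dle x; lia.
  split=> //; split=> //= v; rewrite /upd ltnS leq_eqVlt -[val v == val x]/(v == x).
  by case: eqP => [->|_] //=; exact: s2E.
have valS (v : 'I_n) : v < x.+1 -> v = x \/ v < x.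
  by rewrite ltnS leq_eqVlt => /predU1P[/val_inj->|]; [left|right].
rewrite /f; apply: wp_seq; rewrite add1n; apply: wp_if; rewrite /= s1X s1L => tab.
  apply: wp_skip; have [y lyx Ey] : exists2 y : 'I_n, y < x & lab y = lab x.
    have : ~~ new_class x.
      apply: contra tab => /forallP new; apply/eqP/s1T0 => v lv.
      by have /implyP/(_ lv) := new v.
    rewrite negb_forall => /existsP[y]; rewrite negb_imply negbK => /andP[lt /eqP E].
    by exists y.
  have tabx : ar s1 aTab (lab x) = ecc e x - d c x + 1.
    rewrite -Ey s1T //; have := ecc_label Ey; have := dle x; have := dle y; lia.
  apply: finish => // [v /valS[->//|]|l nl]; first exact: s1T.
  by apply: s1T0 => v lv; apply: nl; exact: ltnW.
have new : new_class x.
  apply/forallP => y; apply/implyP => lt; apply/eqP => E.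
  by move: tab; rewrite -E s1T // addn1.
rewrite new; have -> : b + 2 = 1 + (b + 1) by lia.
apply: wp_seq; apply: wp_set; apply: wp_seq; rewrite /= s1X.
have ok2 := graph_ok_setr x ok1 (isT : vSrc != vN).
apply: (wp_conseq (bfsP e_conn deg_le (src := x) ok2 _)) => // s2 [fr2 {}ok2 s2D [u s2U du]].
have s2X : rg s2 vX = x by rewrite (fr2.1 vX).
have s2C (v : 'I_n) : ar s2 aC v = (d c v).+1 by rewrite (fr2.2 aC) //= s1C.
have s2L (v : 'I_n) : ar s2 aLab v = lab v by rewrite (fr2.2 aLab) //= s1L.
have s2T : ar s2 aTab = ar s1 aTab by rewrite (fr2.2 aTab).
have s2E : ar s2 aE = ar s1 aE by rewrite (fr2.2 aE).
apply: wp_put; rewrite /= s2X s2U s2D du s2C s2L subSS.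
apply: finish => //= [v lv|l nl|v lv]; last by rewrite s2E s1E.
- rewrite s2T /upd; case: eqP => [E|ne].
    by have := ecc_label E; have := dle x; have := dle v; lia.
  by have [vx|lt] := valS v lv; [case: ne; rewrite vx|exact: s1T].
- rewrite s2T /upd; have := nl x (ltnSn x); rewrite eq_sym => /negPf->.
  by apply: s1T0 => v lv; apply: nl; exact: ltnW.
Qed.

End Solving.

Hypothesis e_irr : irreflexive e.

Definition total_cost := 7 * n + 5 + (center_cost + (label_cost + (class_cost + 1))).

(** Cell 0 of [aE] is described relative to cell 1, because for [n = 1] the latter holds no
    eccentricity. *)
Lemma eccentricitiesP s : rg s vL = offset e n ->
  (forall i : nat, i != 0 -> i != 2 -> ar s aIn i = input e i) -> ar s aIn 2 = 0 ->
  (forall a i, 0 < a < 16 -> ar s a i = 0) ->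
  wp eccentricities total_cost
    (fun s' => [/\ rg s' vN = n, forall v : 'I_n, 0 < v -> ar s' aE v = ecc e v &
       ar s' aE 0 = ecc e (Ordinal n_gt0) + ar s' aE 1]) s.
Proof.
move=> sL sIn s2 s0; apply: wp_seq.
have parsed := parseP e_sym e_irr e_conn n_gt0 sL sIn s2.
apply: (wp_conseq (wp_frame parsed)) => // s1 [ok1 fr1].
apply: wp_seq; apply: (wp_conseq (wp_frame (find_centerP ok1))) => // s3 [[ok3 [c cc s3C]] fr3].
have s3L (v : 'I_n) : ar s3 aLab v = 0 by rewrite (fr3.2 aLab) // (fr1.2 aLab) // s0.
have s3T l : ar s3 aTab l = 0 by rewrite (fr3.2 aTab) // (fr1.2 aTab) // s0.
apply: wp_seq; apply: (wp_conseq (wp_frame (label_ballP ok3 s3C s3L))) => // s4 [s4L fr4].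
have ok4 := graph_ok_frame ok3 fr4 isT.
have s4C (v : 'I_n) : ar s4 aC v = (d c v).+1 by rewrite (fr4.2 aC) // s3C.
have s4T l : ar s4 aTab l = 0 by rewrite (fr4.2 aTab) // s3T.
apply: wp_seq; apply: (wp_conseq (wp_frame (solve_classesP cc ok4 s4C s4L s4T))) => //.
move=> s5 [s5E fr5]; have [s5N _ _] := graph_ok_frame ok4 fr5 isT.
apply: wp_put; split=> //= [v v0|]; rewrite /upd /=.
  by case: eqP v0 => [->|_ _] //; exact: s5E.
by rewrite (s5E (Ordinal n_gt0)).
Qed.

End Phases.

(** * The complete program and its cost *)

Definition program : rcmd := RSeq prelude (RSeq (ccmd eccentricities) postlude).

(** The summands in parentheses bound, per vertex, parsing, centre, labels, classes and the last
    command; [13 * D + 250] covers moving the input and the output. *)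
Definition cost_factor (D : nat) : nat :=
  weight eccentricities *
    (12 + (24 * D + 74) + (D.+1 ^ ball_radius * (8 * D + 24) + 5) +
     (2 ^ (D.+1 ^ ball_radius) * (8 * D + 19) + 6) + 1) + 13 * D + 250.

Lemma total_cost_le n D : 0 < n ->
  total_cost n D <= n * (12 + (24 * D + 74) + (D.+1 ^ ball_radius * (8 * D + 24) + 5) +
     (2 ^ (D.+1 ^ ball_radius) * (8 * D + 19) + 6) + 1).
Proof.
move=> n0; rewrite /total_cost /center_cost /label_cost /class_cost.
have ble : bfs_cost n D <= n * (8 * D + 17) by rewrite /bfs_cost; lia.
move: (D.+1 ^ _) (2 ^ _) => Q R.
have leQ : Q * (bfs_cost n D + 4 * n + 3) <= Q * (n * (8 * D + 24)).
  by rewrite leq_mul2l; apply/orP; right; lia.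
have leR : R * (bfs_cost n D + 2) <= R * (n * (8 * D + 19)).
  by rewrite leq_mul2l; apply/orP; right; lia.
lia.
Qed.

Theorem theorem8 :
  exists P : seq instr, forall D : nat, exists C : nat,
    forall (n : nat) (e : rel 'I_n),
      symmetric e -> irreflexive e -> (0 < n)%N ->
      gconnected e -> chordal e ->
      (forall v, (degree e v <= D)%N) ->
      exists mem, exec P (C * (nedges e).+1) 0 (init_mem (enc_graph e)) = Some mem /\
                  forall v : 'I_n, is_ecc e v (mem (val v)).
Proof.
exists (code 0 program) => D; exists (cost_factor D) => n e e_sym e_irr n_gt0 e_conn e_chordal deg.
have [B [s [m1 [t1 [ev1 le1 nB rp1 [sL sIn s2 s0]]]]]] := preludeP n_gt0 e_conn.
have [s' [t [cev let' [s'N s'E s'0]]]] :=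
  eccentricitiesP e_sym e_conn e_chordal deg n_gt0 e_irr sL sIn s2 s0.
have [m2 [t2 [ev2 le2 rp2]]] :=
  ccmd_correct cev (isT : wfcmd eccentricities) (leqnn _) rp1.
have [KB mB mr ma] := rp2.
have [||m3 [t3 [ev3 le3 m30 m3x]]] := @postludeP B n (ar s' aE) nB KB m2.
- by split=> // i; rewrite ma.
- by rewrite mr.
exists m3; split.
  apply: (@exec_rcmd program _ (t1 + (t2 + t3))).
  - by rewrite -[rwf _]/[&& rwf prelude, rwf (ccmd eccentricities) & rwf postlude] rwf_ccmd.
  - exact: RevSeq ev1 (RevSeq ev2 ev3).
  have lt2 : t2 <= weight eccentricities * total_cost n D.
    by apply: leq_trans le2 _; rewrite leq_mul2l let' orbT.
  have lt2' := leq_trans lt2 (leq_mul (leqnn _) (total_cost_le D n_gt0)).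
  have lo := offset_le deg (leqnn n); have nm := connected_nedges e_sym e_conn.
  apply: (@leq_trans (cost_factor D * n)); last by rewrite leq_mul2l nm orbT.
  rewrite /cost_factor; move: (weight _) lt2' => W.
  by move: (12 + _ + _ + _ + 1) => G; lia.
move=> v; have -> : m3 (val v) = ecc e v; last exact: is_ecc_ecc.
have le01 : ar s' aE 1 <= ar s' aE 0 by rewrite s'0 leq_addl.
have [m3_0 m3_1] := m30 le01.
(* Cells 0 and 1 result from the final subtractions; the others are plain copies. *)
case: v => [[|[|v]] lv] /=.
- by rewrite m3_0 s'0 addnK; congr (ecc e _); apply: val_inj.
- by rewrite m3_1; exact: (s'E (Ordinal lv)).
- by rewrite m3x //; exact: (s'E (Ordinal lv)).
Qed.
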